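(* (1) There exists a regular self-similar arc $\Lambda$ with $\theta_{\min}=0$ such that $\Lambda$ is a $t$-quasi-arc for no $t\ge1$. (2) Let $t_0>1$. Then there exists a regular self-similar arc $\Lambda$ with $\theta_{\min}=0$ such that $\Lambda$ is a $t_0$-quasi-arc, but $\Lambda$ is a $t$-quasi-arc for no $t$ with $1\le t<t_0$. (3) Let $t_0\ge1$. Then there exists a regular self-similar arc $\Lambda$ with $\theta_{\min}=0$ such that $\Lambda$ is a $t$-quasi-arc for each $t>t_0$, but $\Lambda$ is not a $t_0$-quasi-arc.
   Context: Identify $\mathbb{R}^2$ with $\mathbb{C}$. Basic figures. Let $\Omega$ be a polygon formed by a sequence of successive segments in the plane, with $\ell+1$ vertices $z_0,z_1,\dots,z_\ell$, such that $z_1,z_{\ell-1}$ lie on the segment $\overline{z_0z_\ell}$ and $z_{\ell-1}$ lies on the segment $\overline{z_1z_\ell}$. Suppose there is a vertex $z_q$ such that all vertices belong to $\Pi=\{z_q\}\cup\overline{z_0z_\ell}\cup\Pi_0$, where $\Pi_0$ is the interior of the triangle $z_0z_\ell z_q$; let $\Pi_1$ be the closure of $\Pi_0$. For $j=1,\dots,\ell$ let $S_j$ be the unique orientation-preserving similitude (of the form $z\mapsto az+b$) with $S_j(z_0)=z_{j-1}$, $S_j(z_\ell)=z_j$. $\Omega$ is a basic figure if moreover: the $S_j$ are contractive; the sets $S_j(\Pi_0)$ are pairwise disjoint; $S_j(z_q)\in\Pi_1$ for all $j$; and $S_j(\Pi_1)\cap(\overline{z_qz_0}\cup\overline{z_qz_\ell})=\emptyset$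 for $j\notin\{1,\ell,q,q+1\}$. Standing assumption: $\operatorname{Im}\frac{z_q-z_0}{z_\ell-z_0}>0$. Angles (all arguments in $[0,2\pi)$). Corner angle at $z_p$, $1\le p\le\ell-1$: $\theta_p=\arg\frac{S_p(z_q)-z_p}{S_{p+1}(z_q)-z_p}$. Put $\theta_{\min}=\min_p\theta_p$, $\eta_1=\arg\frac{S_q(z_q)-z_q}{z_0-z_q}$, $\eta_2=\arg\frac{z_\ell-z_q}{S_{q+1}(z_q)-z_q}$, $\eta_0=\min(\eta_1,\eta_2)$. The characteristic angle is $\xi=\theta_{\min}+\eta_0$. Regular self-similar arcs. Let $\Lambda$ be the unique nonempty compact set with $\Lambda=\bigcup_{j=1}^\ell S_j(\Lambda)$. If $\Lambda$ is an arc (homeomorphic to $[0,1]$), it is called the self-similar arc generated by $\Omega$. A regular self-similar arc is a self-similar arc generated by a basic figure with positive characteristic angle; its $\theta_{\min}$ is that of the generating basic figure. For $t\ge1$, an arc $\Lambda$ is a $t$-quasi-arc if there is $\lambda>0$ with $|\Lambda(x,y)|^t\le\lambda|x-y|$ for all $x,y\in\Lambda$, where $|\Lambda(x,y)|$ is the diameter of the subarc of $\Lambda$ between $x$ and $y$. *)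

(* Defs.v *)
From HB Require Import structures.
From mathcomp Require Import all_boot all_order all_algebra.
From mathcomp Require Import all_classical all_reals all_analysis.
From mathcomp Require Import complex ring lra.

Set Implicit Arguments.
Unset Strict Implicit.
Unset Printing Implicit Defensive.

Import Order.TTheory GRing.Theory Num.Theory.
Import numFieldNormedType.Exports.
Import ComplexField.Normc.

Local Open Scope classical_set_scope.
Local Open Scope ring_scope.
Local Open Scope complex_scope.

(* R[i] itself carries no topology in the library; seen as a numClosedFieldType
   it gets the one of the modulus. *)
Definition plane (R : realType) : numClosedFieldType := R[i].

Section Plane.
Variable R : realType.
Local Notation C := (plane R).

Definition dist (x y : C) : R := normc (x - y).

Definition diam (A : set C) : R := sup [set dist x y | x in A & y in A].

(* The argument of z in [0, 2 pi[; the value at z = 0 is irrelevant. *)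
Definition carg (z : C) : R :=
  if 0 <= complex.Im z then acos (complex.Re z / normc z)
  else 2 * pi - acos (complex.Re z / normc z).

Lemma cargP (z : C) : z != 0 ->
  0 <= carg z < 2 * pi /\ z = (normc z)%:C * (cos (carg z) +i* sin (carg z)).
Proof.
case: z => a b z0; rewrite /carg /=.
set r := Num.sqrt _.
have s0 : 0 < a ^+ 2 + b ^+ 2.
  rewrite lt_neqAle addr_ge0 ?sqr_ge0// andbT eq_sym.
  apply: contra z0 => /eqP s0; apply/eqP.
  move: s0 => /eqP; rewrite paddr_eq0 ?sqr_ge0// !sqrf_eq0 => /andP[/eqP a0 /eqP b0].
  by rewrite a0 b0.
have r0 : 0 < r by rewrite sqrtr_gt0.
have r2 : r ^+ 2 = a ^+ 2 + b ^+ 2 by rewrite sqr_sqrtr ?ltW.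
have ler : `|a| <= r by rewrite -sqrtr_sqr ler_wsqrtr// lerDl sqr_ge0.
have ar : -1 <= a / r <= 1.
  move: ler; rewrite ler_norml => /andP[h1 h2].
  by rewrite ler_pdivlMr// ler_pdivrMr// mulN1r mul1r h1 h2.
have arI : a / r \in `[(-1), 1] by rewrite in_itv.
have sE : sin (acos (a / r)) = `|b| / r.
  rewrite sin_acos// -[r in RHS](@ger0_norm _ r) ?ltW// -normf_div -sqrtr_sqr.
  congr Num.sqrt; rewrite !exprMn !exprVn r2; field.
  by rewrite -r2; apply: lt0r_neq0; rewrite ?exprn_gt0.
have p0 := @pi_gt0 R.
case: ifPn => b0.
- split.
    rewrite acos_ge0//= (le_lt_trans (acos_lepi ar))//; lra.
  rewrite acosK// sE ger0_norm//.
  apply/eqP; rewrite eq_complex /=; apply/andP; split; apply/eqP;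
    field; exact: lt0r_neq0.
- have bn : b < 0 by rewrite ltNge.
  have ac0 : 0 < acos (a / r).
    apply: acos_gt0; move: ar => /andP[-> _] /=.
    rewrite ltr_pdivrMr// mul1r.
    have : `|a| < r.
      by rewrite -sqrtr_sqr ltr_sqrt// ltrDl exprn_even_gt0//= lt_eqF.
    by rewrite ltr_norml => /andP[].
  have acpi := acos_lepi ar.
  split; first by apply/andP; split; lra.
  have -> : 2 * pi - acos (a / r) = - acos (a / r) + pi + pi :> R by ring.
  rewrite cosDpi sinDpi cosDpi sinDpi !opprK cosN sinN acosK// sE ltr0_norm//.
  apply/eqP; rewrite eq_complex /=; apply/andP; split; apply/eqP;
    field; exact: lt0r_neq0.
Qed.

Definition seg (a b : C) : set C := [set a + t%:C * (b - a) | t in `[0, 1]%classic].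

Definition triangle (a b c : C) : set C :=
  [set p | exists u v w : R, [/\ 0 <= u, 0 <= v, 0 <= w, u + v + w = 1 &
    p = u%:C * a + v%:C * b + w%:C * c]].

(* The vertices are z 0, ..., z l; the values z p with p > l play no role. *)
Section Figure.
Variables (l : nat) (z : nat -> C) (q : nat).

(* S_j, for 1 <= j <= l. *)
Definition simil (j : nat) (w : C) : C :=
  z j.-1 + (z j - z j.-1) / (z l - z 0) * (w - z 0).

Lemma simil_unique (j : nat) (a b : C) : z 0 != z l ->
  (forall w, a * w + b = simil j w) <->
  (a * z 0 + b = z j.-1 /\ a * z l + b = z j).
Proof.
move=> z0l; have d0 : z l - z 0 != 0 by rewrite subr_eq0 eq_sym.
rewrite /simil; split=> [h | [<- <-] w].
  by split; rewrite h; field.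
by field.
Qed.

Definition Pi0 : set C := interior (triangle (z 0) (z l) (z q)).
Definition Pi1 : set C := closure Pi0.

Record basic_figure : Prop := BasicFigure {
  bf_vertices : forall p p', (p <= l)%N -> (p' <= l)%N -> z p = z p' -> p = p';
  bf_first : seg (z 0) (z l) (z 1);
  bf_last : seg (z 0) (z l) (z l.-1);
  bf_last_first : seg (z 1) (z l) (z l.-1);
  bf_apex : (q <= l)%N;
  bf_in : forall p, (p <= l)%N -> ([set z q] `|` seg (z 0) (z l) `|` Pi0) (z p);
  bf_contractive : forall j, (1 <= j <= l)%N ->
    exists2 c : R, c < 1 &
      forall x y, dist (simil j x) (simil j y) <= c * dist x y;
  bf_disjoint : trivIset [set j | (1 <= j <= l)%N] (fun j => simil j @` Pi0);
  bf_apex_in : forall j, (1 <= j <= l)%N -> Pi1 (simil j (z q));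
  bf_sides : forall j, (1 <= j <= l)%N -> j \notin [:: 1; l; q; q.+1]%N ->
    simil j @` Pi1 `&` (seg (z q) (z 0) `|` seg (z q) (z l)) = set0;
  bf_orientation : 0 < complex.Im ((z q - z 0) / (z l - z 0))
}.

Definition theta (p : nat) : R :=
  carg ((simil p (z q) - z p) / (simil p.+1 (z q) - z p)).

Definition theta_min : R := \big[Num.min/theta 1]_(1 <= p < l) theta p.

Definition eta1 : R := carg ((simil q (z q) - z q) / (z 0 - z q)).
Definition eta2 : R := carg ((z l - z q) / (simil q.+1 (z q) - z q)).
Definition eta0 : R := Num.min eta1 eta2.

Definition characteristic_angle : R := theta_min + eta0.

Definition self_similar_set (L : set C) : Prop :=
  [/\ L !=set0, compact L &
      L = \bigcup_(j in [set j | (1 <= j <= l)%N]) simil j @` L].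

End Figure.

(* f is a homeomorphism from [0, 1] onto L, with inverse g. *)
Definition arc_param (L : set C) (f : R -> C) (g : C -> R) : Prop :=
  [/\ set_fun `[0, 1] L f /\ set_fun L `[0, 1] g,
      (forall t, `[0, 1]%classic t -> g (f t) = t),
      (forall p, L p -> f (g p) = p),
      {within `[0, 1], continuous f} &
      {within L, continuous g}].

Definition is_arc (L : set C) : Prop := exists f g, arc_param L f g.

(* The part of L between x and y does not depend on the parametrization. *)
Definition subarc (L : set C) (x y : C) : set C :=
  [set p | exists f g, [/\ arc_param L f g, L p &
    Num.min (g x) (g y) <= g p <= Num.max (g x) (g y)]].

Definition quasi_arc (t : R) (L : set C) : Prop :=
  exists2 lambda : R, 0 < lambda & forall x y, L x -> L y ->
    diam (subarc L x y) `^ t <= lambda * dist x y.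

Definition regular_self_similar_arc (l : nat) (z : nat -> C) (q : nat)
    (L : set C) : Prop :=
  [/\ basic_figure l z q, 0 < characteristic_angle l z q,
      self_similar_set l z L & is_arc L].

End Plane.

(* Main.v *)
(* The figure has five segments, with vertices 0, 4/9, z_2, p = 1/2 + i/6, 1 - b, 1
   and apex p.  The direction of z_2 - z_1 is chosen so that the sides
   z_1 S_1(p) and z_1 S_2(p) lie on the same ray: theta_1 = 0.  Near z_1 the two
   pieces touch this ray only at the points at distances proportional to
   (4/9) b^n and r (4/9)^m, which are the scales of the sub-pieces containing
   them; so the t-quasi-arc condition says exactly that
   ((4/9) b^n)^t <= lambda |(4/9) b^n - r (4/9)^m| for all n and m.
   With b = (4/9)^(sqrt 2) and r = (4/9)^(6 - kappa) the ratio of the two sizes is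
   (4/9)^(kappa + n sqrt 2 - m - 5), and the condition compares b^(n (t - 1)) with
   |kappa + n sqrt 2 - m - 5|.  Since sqrt 2 is badly approximable, kappa can be
   chosen as a lacunary sum of powers of 3 - 2 sqrt 2 so that the best
   inhomogeneous approximations have any prescribed rate psi(n) <= 1/(n + 1),
   which settles the three cases. *)
Require Import Defs.
From mathcomp Require Import all_boot all_order all_algebra.
From mathcomp Require Import all_classical all_reals all_analysis.
From mathcomp Require Import complex ring lra zify.

Set Implicit Arguments.
Unset Strict Implicit.
Unset Printing Implicit Defensive.

Import Order.TTheory GRing.Theory Num.Theory.
Import numFieldNormedType.Exports.
Import ComplexField.Normc.

Local Open Scope classical_set_scope.
Local Open Scope ring_scope.
Local Open Scope complex_scope.


(** * Inhomogeneous approximation by multiples of the square root of two *)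

Section InhomogeneousApproximation.
Variable R : realType.
Implicit Types (n m : nat) (q x : R).

(** Only the corner with angle 0 may matter, so every other pair of pieces must give a linear bound:
    non-adjacent pieces are a positive distance apart, and at the remaining corners adjacent pieces
    lie in sectors separated by a positive angle. At [z_1] each piece departs from the common ray at
    least linearly in the distance to the touching point of its scale; hence distances there reduce,
    up to constants, to differences of sizes. The choice of [b] freezes the homogeneous part of the
    approximation problem, and only the offset varies, through [r]. Thus [b] and [r] stay in fixed
    rational intervals and the geometry is checked once, by polynomial arithmetic. The lacunary sum
    works because an unplanned pair differs from a planned one by a form [x sqrt 2 - y] with small
    [x], which is at least a constant over [n + 1]. This is the origin of the ceiling [1/(n + 1)]
    for [psi]. *)

Lemma exp_lt_exists q x : 0 <= q < 1 -> 0 < x -> exists n, q ^+ n < x.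
Proof.
move=> /andP[q0 q1] x0.
have /cvgrPdist_lt/(_ _ x0)[N _ hN] : (GRing.exp q : R^nat) @ \oo --> (0 : R).
  by apply: cvg_expr; rewrite ger0_norm.
exists N; have := hN N (leqnn N); rewrite /= sub0r normrN.
by rewrite ger0_norm ?exprn_ge0.
Qed.

Definition sqrt2 : R := Num.sqrt 2.

Lemma sqrt2_sqr : sqrt2 * sqrt2 = 2.
Proof. by rewrite -expr2 sqr_sqrtr. Qed.

Lemma sqrt2_bounds : 14 / 10 < sqrt2 < 142 / 100.
Proof.
have s0 : 0 <= sqrt2 by rewrite sqrtr_ge0.
have := sqrt2_sqr; move: sqrt2 s0 => s s0 ss; apply/andP; split; nra.
Qed.

(** The norm [2 x^2 - y^2] is a nonzero integer, so the product of the two conjugate forms is at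
    least 1 in modulus; unless the first form is already large, the second is at most [6 |x|]. *)
Lemma sqrt2_diophantine (x y : int) : x != 0 ->
  1 / (6 * `|x%:~R : R|) <= `|x%:~R * sqrt2 - y%:~R|.
Proof.
move=> x0; have /andP[s1 s2] := sqrt2_bounds; have ss := sqrt2_sqr.
have x1 : 1 <= `|x%:~R : R| by rewrite -intr_norm ler1z; lia.
(* The 2-adic valuation is odd on the left and even on the right. *)
have irr : 2 * x ^+ 2 != y ^+ 2.
  apply/eqP => /(congr1 absz).
  rewrite abszM !abszX => /(congr1 (logn 2)).
  rewrite lognM ?expn_gt0 ?absz_gt0 ?x0 // !lognX.
  rewrite (_ : logn 2 _ = 1)%N //.
  move: (logn 2 `|x|) (logn 2 `|y|) => i j; lia.
have key : 1 <= `|x%:~R * sqrt2 - y%:~R| * `|x%:~R * sqrt2 + y%:~R|.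
  rewrite -normrM.
  have -> : (x%:~R * sqrt2 - y%:~R) * (x%:~R * sqrt2 + y%:~R) =
            (2 * x ^+ 2 - y ^+ 2)%:~R :> R.
    rewrite rmorphB rmorphM !rmorphXn /=.
    transitivity (x%:~R ^+ 2 * (sqrt2 * sqrt2) - y%:~R ^+ 2 : R); first by ring.
    by rewrite ss mulrC.
  rewrite -intr_norm ler1z -gtz0_ge1 normr_gt0 subr_eq0.
  exact: irr.
rewrite ler_pdivrMr; last by lra.
have up : `|x%:~R * sqrt2 + y%:~R| <=
          `|x%:~R * sqrt2 - y%:~R| + 3 * `|x%:~R : R|.
  have -> : x%:~R * sqrt2 + y%:~R =
    - (x%:~R * sqrt2 - y%:~R) + x%:~R * (2 * sqrt2) :> R by ring.
  rewrite (le_trans (ler_normD _ _))// normrN lerD2l normrM.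
  by rewrite mulrC ler_wpM2r // ger0_norm; lra.
move: (normr_ge0 (x%:~R * sqrt2 - y%:~R)) (normr_ge0 (x%:~R * sqrt2 + y%:~R)).
move: x1 up key.
set d := Num.norm (_ - _); set e := Num.norm (_ + _); set X := Num.norm _.
move=> X1 up key d0 e0.
case: (leP (3 * X) d) => h; nra.
Qed.

(* [(3 - 2 sqrt 2) ^ j = P - Q sqrt 2] and [(3 + 2 sqrt 2) ^ j = P + Q sqrt 2]. *)
Fixpoint pell (j : nat) : nat * nat :=
  if j is i.+1 then
    let: (p, q) := pell i in (3 * p + 4 * q, 2 * p + 3 * q)%N
  else (1%N, 0%N).

Definition pell_unit : R := 3 - 2 * sqrt2.
Local Notation v := pell_unit.

Lemma pell_unit_bounds : 0 < v < 1 / 5 /\ 1 / 10 < v.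
Proof.
have := sqrt2_sqr; have := sqrt2_bounds; rewrite /v => /andP[h1 h2] h3.
split; first (apply/andP; split); lra.
Qed.

Lemma pellE j : v ^+ j = (pell j).1%:R - (pell j).2%:R * sqrt2.
Proof.
elim: j => [|j]; rewrite ?expr0 /= ?mul0r ?subr0 //.
case: (pell j) => p q /= IH; rewrite exprSr IH /v (natrD _ (3 * p)) (natrD _ (2 * p)) !natrM.
have := sqrt2_sqr => ss; ring: ss.
Qed.

Lemma pell_conjE j : v ^+ j * ((pell j).1%:R + (pell j).2%:R * sqrt2) = 1.
Proof.
elim: j => [|j]; rewrite ?expr0 /= ?mul1r ?mul0r ?addr0 //.
case: (pell j) => p q /= IH.
rewrite exprSr -[RHS]IH /v (natrD _ (3 * p)) (natrD _ (2 * p)) !natrM.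
have := sqrt2_sqr => ss; ring: ss.
Qed.

(** The two formulas for the powers of the unit give [2 sqrt 2 Q v^j = 1 - v^(2 j)], so the error
    [v^j] is of the order of [1 / Q]. *)
Lemma pell_size j : (0 < j)%N ->
  (pell j).2%:R * v ^+ j <= 1 /\ 1 <= 4 * ((pell j).2%:R * v ^+ j).
Proof.
move=> j0; have := pellE j; have := pell_conjE j.
have /andP[s1 s2] := sqrt2_bounds; have [/andP[v0 v1] _] := pell_unit_bounds.
have vj : v ^+ j <= 1 / 5.
  case: j j0 => // j _; rewrite exprS.
  have : v ^+ j <= 1 by rewrite exprn_ile1 // ltW //; lra.
  have : 0 <= v ^+ j by rewrite exprn_ge0 // ltW.
  move: (v ^+ j) => V; nra.
have vj0 : 0 < v ^+ j by rewrite exprn_gt0.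
have p0 : 0 <= (pell j).1%:R :> R by [].
have q0 : 0 <= (pell j).2%:R :> R by [].
move: (pell j).1%:R (pell j).2%:R (v ^+ j) p0 q0 vj vj0 => p q V p0 q0 V1 V0 e1 e2.
have e3 : 2 * (q * V * sqrt2) = 1 - V * V.
  have : V * V = V * (p - q * sqrt2) by rewrite -e2.
  lra.
have qV : 0 <= q * V by rewrite mulr_ge0 // ltW.
split; nra.
Qed.


(** * The offset as a lacunary sum of powers of [3 - 2 sqrt 2] *)

Section Expansion.
Variable J : nat -> nat.
Hypothesis J_large : forall n, v ^+ J n * (24 * (n%:R + 1)) <= 1.

(* [(freq k, freq_int k)] are the successive exceptional pairs [(n, m)]: the
   partial sum [s k] of the offset is [m - n sqrt 2], and the next term
   [v ^ J n] is the error that this pair is meant to realise. *)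
Fixpoint freq k : nat := if k is i.+1 then freq i + (pell (J (freq i))).2 else 0.
Fixpoint freq_int k : nat :=
  if k is i.+1 then freq_int i + (pell (J (freq i))).1 else 0.
Let e k : R := v ^+ J (freq k).
Let s k : R := (freq_int k)%:R - (freq k)%:R * sqrt2.

Let e_gt0 k : 0 < e k.
Proof. by apply: exprn_gt0; case: pell_unit_bounds => /andP[]. Qed.

Lemma J_gt0 n : (0 < J n)%N.
Proof.
have := J_large n; case: (J n) => // ; rewrite expr0 mul1r.
have : 0 <= n%:R :> R by []. lra.
Qed.

(** By [pell_size] a frequency is comparable to the inverse of the preceding error. With [J_large]
    this pushes each error below a sixth of the one before. *)
Lemma freq_size k : 1 <= 4 * ((freq k.+1)%:R * e k) /\
  (freq k.+1)%:R * e k <= (freq k)%:R * e k + 1.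
Proof.
rewrite /= natrD; have [] := pell_size (J_gt0 (freq k)); rewrite -/(e k).
have : 0 <= (freq k)%:R * e k by rewrite mulr_ge0 // ltW.
lra.
Qed.

Let e_half k : e k.+1 <= e k / 6.
Proof.
have [h _] := freq_size k; have := J_large (freq k.+1); rewrite -/(e k.+1).
have := e_gt0 k; have := e_gt0 k.+1; move: h.
have : 0 <= (freq k.+1)%:R :> R by [].
move: (_%:R) (e k) (e k.+1) => N E E' N0 h1 h2 h3 h4.
have : 24 * E' * (N * E) <= E by nra.
nra.
Qed.

Let e_lt k : e k < (1 / 2) ^+ k.
Proof.
elim: k => [|k IH].
  have : e 0%N * (24 * (0 + 1)) <= 1 := J_large 0.
  by rewrite expr0; have := e_gt0 0%N; lra.
rewrite exprS; have := e_half k; have := e_gt0 k; lra.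
Qed.

Let sS k : s k.+1 = s k + e k.
Proof. by rewrite /s /e /= !natrD pellE; ring. Qed.

(** [s] increases while [s + 2 e] decreases, so the intervals between them are nested. *)
Let s_lt k i : s i + e i <= s k + 2 * e k.
Proof.
have hu i0 d : s i0 <= s (i0 + d) /\ s (i0 + d) + 2 * e (i0 + d) <= s i0 + 2 * e i0.
  elim: d => [|d [IH1 IH2]]; first by rewrite addn0.
  rewrite addnS sS; have := e_half (i0 + d); have := e_gt0 (i0 + d).
  by split; lra.
have := e_gt0 i; have := e_gt0 k.
case: (leqP i k) => [/subnKC <-|/ltnW/subnKC <-].
  have [] := hu i.+1 (k - i)%N; have [] := hu i (k - i)%N.
  rewrite sS addSn -addnS; set d := (k - i)%N; rewrite addnS sS.
  by have := e_half (i + d); have := e_gt0 (i + d); lra.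
by have [_] := hu k (i - k)%N; lra.
Qed.

Definition offset : R := sup (range s).

Let offset_bounds k : s k + e k <= offset <= s k + 2 * e k.
Proof.
apply/andP; split.
  rewrite -sS; apply: ub_le_sup; last by exists k.+1.
  exists (s 0%N + 2 * e 0%N) => _ [i _ <-].
  by have := s_lt 0%N i; have := e_gt0 i; lra.
apply: ge_sup; first by exists (s 0%N), 0%N.
by move=> _ [i _ <-]; have := s_lt k i; have := e_gt0 i; lra.
Qed.

Lemma offset_unit : 0 <= offset <= 1.
Proof.
have := offset_bounds 0%N; have := e_gt0 0%N.
have : e 0%N * (24 * (0 + 1)) <= 1 := J_large 0.
have -> : s 0%N = 0 by rewrite /s /= mul0r subr0.
lra.
Qed.

Lemma offset_approx k :
  v ^+ J (freq k) <= offset + (freq k)%:R * sqrt2 - (freq_int k)%:R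
                  <= 2 * v ^+ J (freq k).
Proof. have := offset_bounds k; rewrite /s -/(e k); lra. Qed.

Lemma freq_ge k : (k <= freq k)%N.
Proof.
elim: k => //= k IH; rewrite -addn1 leq_add //.
have [_] := pell_size (J_gt0 (freq k)); case: (pell _).2 => //.
by rewrite mul0r mulr0; lra.
Qed.

(** Compare [(n, m)] with a planned pair whose tail is negligible at scale [n]. Either it is that
    pair, or it has the same [n] and an error of at least 1/2, or the two forms differ by
    [x sqrt 2 - y] with [x] nonzero, to which [sqrt2_diophantine] applies. *)
Lemma offset_far n m :
  v ^+ J n <= `|offset + n%:R * sqrt2 - m%:R| \/
  1 / (300 * (n%:R + 1)) <= `|offset + n%:R * sqrt2 - m%:R|.
Proof.
have n0 : 0 <= n%:R :> R by [].
have [k hk kmin] : exists2 k, 24 * n%:R * e k <= 1 &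
    forall i, 24 * n%:R * e i <= 1 -> (k <= i)%N.
  have : exists k, 24 * n%:R * e k <= 1.
    have h1 : 0 < 24 * n%:R + 1 :> R by lra.
    have [||k] := @exp_lt_exists (1 / 2) (1 / (24 * n%:R + 1)); first lra.
      by rewrite divr_gt0.
    rewrite ltr_pdivlMr // => h2.
    exists k; have := e_lt k; have := e_gt0 k; nra.
  by move=> ex; exists (ex_minn ex); case: ex_minnP.
have ek := e_gt0 k; have /andP[a1 a2] := offset_approx k.
have [nk|nk] := eqVneq n (freq k).
  rewrite nk; have [->|mk] := eqVneq m (freq_int k).
    by left; rewrite (le_trans a1) // ler_norm.
  have h1 : 1 <= `|(freq_int k)%:R - m%:R : R|.
    rewrite !pmulrn -rmorphB -intr_norm ler1z -gtz0_ge1 normr_gt0 subr_eq0.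
    by rewrite eqz_nat eq_sym.
  right.
  have := ler_distD (offset + (freq k)%:R * sqrt2) (freq_int k)%:R m%:R.
  rewrite [X in _ <= X + _]distrC [X in _ <= X + _]ger0_norm; last lra.
  have N0 : 0 <= (freq k)%:R :> R by [].
  have := J_large (freq k); rewrite -/(e k) in a1 a2 * => h2 h3.
  apply: (@le_trans _ _ (1 / 2)); last by nra.
  by rewrite ler_pdivrMr; lra.
right.
have nk0 : n%:Z - (freq k)%:Z != 0 by rewrite subr_eq0 eqz_nat.
have := sqrt2_diophantine (m%:Z - (freq_int k)%:Z) nk0.
rewrite !rmorphB /= -!pmulrn => hd.
have N0 : 0 <= (freq k)%:R :> R by [].
have h0 : (freq k)%:R * (24 * e k) <= 1.
  by have := J_large (freq k); rewrite -/(e k); nra.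
(* The tail [2 e k] uses up at most half of the Diophantine bound. When [n < freq k], minimality of
   [k] gives [freq k <= 25 n], whence [300 = 12 * 25]. *)
have hM : `|n%:R - (freq k)%:R : R| * (12 * (2 * e k)) <= 1 /\
          12 * `|n%:R - (freq k)%:R : R| <= 300 * (n%:R + 1).
  case: (leP (freq k)%:R (n%:R : R)) => fn.
    by rewrite ger0_norm ?subr_ge0 //; split; nra.
  rewrite ltr0_norm ?subr_lt0 // opprB; split; first by nra.
  case: k {hk ek a1 a2 nk nk0 hd h0} N0 fn kmin => [|k] N0 fn kmin.
    by move: fn; rewrite ltNge ler_nat.
  have h1 : 1 < 24 * n%:R * e k.
    by rewrite ltNge; apply/negP => /kmin; rewrite ltnn.
  have [_ h2] := freq_size k; have := J_large (freq k); rewrite -/(e k) => h3.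
  have : (freq k.+1)%:R <= 25 * n%:R :> R; last by lra.
  have := e_gt0 k; move: h1 h2 h3; move: (freq k.+1)%:R (freq k)%:R (e k) => F' F E.
  by move=> h1 h2 h3 E0; rewrite -(ler_pM2r E0); nra.
have x0 : 0 < `|n%:R - (freq k)%:R : R|.
  by rewrite normr_gt0 subr_eq0 eqr_nat.
move: hM hd x0; set x := Num.norm _; set d := Num.norm (_ - _) => -[h1 h2] hd x0.
have h3 : d <= `|offset + n%:R * sqrt2 - m%:R| + 2 * e k.
  rewrite /d (_ : _ - _ = (offset + n%:R * sqrt2 - m%:R) -
    (offset + (freq k)%:R * sqrt2 - (freq_int k)%:R)); last by ring.
  rewrite (le_trans (ler_normB _ _)) // lerD2l ger0_norm //.
  by rewrite -/(e k) in a1; lra.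
have h4 : 1 / (300 * (n%:R + 1)) <= 1 / (12 * x).
  by rewrite !div1r lef_pV2 // posrE; lra.
have h5 : 2 * e k <= 1 / (12 * x).
  by rewrite ler_pdivlMr; lra.
have h6 : 1 / (6 * x) = 1 / (12 * x) + 1 / (12 * x).
  by field; rewrite gt_eqF.
lra.
Qed.

End Expansion.

(** The errors of unplanned pairs are at least a constant over [n + 1], so under the bound on [psi]
    the planned pairs are the best ones, up to the factor [c]. *)
Lemma inhomogeneous_approximation (psi : nat -> R) :
  (forall n, 0 < psi n) -> (forall n, psi n * (n%:R + 1) <= 1) ->
  exists kappa c, [/\ 0 <= kappa <= 1, 0 < c <= 1,
    (forall n m, c * psi n <= `|kappa + n%:R * sqrt2 - m%:R|) &
    (forall N, exists n m, (N <= n)%N /\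
      `|kappa + n%:R * sqrt2 - m%:R| <= psi n)].
Proof.
move=> psi0 psi1; have [/andP[v0 v1] v2] := pell_unit_bounds.
have ex n : exists j, v ^+ j <= psi n / 24.
  have [||j /ltW h] := @exp_lt_exists v (psi n / 24); last by exists j.
    by apply/andP; split; lra.
  by rewrite divr_gt0.
(* As [v > 1/10], the least exponent brings [v ^ J n] within a constant factor of [psi n]; the 24
   secures [J_large]. *)
pose J n := ex_minn (ex n).
have JP n : v ^+ J n <= psi n / 24 /\ psi n / 240 <= v ^+ J n.
  rewrite /J; case: ex_minnP => -[|j] hj jmin.
    have n0 : 0 <= n%:R :> R by [].
    by split=> //; have := psi0 n; have := psi1 n; rewrite expr0 in hj *; nra.
  split=> //; have : psi n / 24 < v ^+ j.
    by rewrite ltNge; apply/negP => /jmin; rewrite ltnn.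
  by have := psi0 n; rewrite exprS; nra.
have J_large n : v ^+ J n * (24 * (n%:R + 1)) <= 1.
  have [h _] := JP n; have := psi1 n; have := psi0 n.
  have : 0 <= n%:R :> R by []. nra.
exists (offset J), (1 / 300); split=> //; first exact: offset_unit.
- by apply/andP; split; lra.
- move=> n m; have [_ h] := JP n; have := psi0 n.
  case: (offset_far J_large n m) => h1; first lra.
  move=> psin; apply: (le_trans _ h1).
  have n0 : 0 <= n%:R :> R by [].
  by rewrite ler_pdivlMr; [have := psi1 n; lra|lra].
- move=> N; exists (freq J N), (freq_int J N); split; first exact: freq_ge.
  have /andP[h1 h2] := offset_approx J_large N.
  have [h3 _] := JP (freq J N); have := exprn_gt0 (J (freq J N)) v0.
  have := psi0 (freq J N); rewrite ger0_norm; lra.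
Qed.

End InhomogeneousApproximation.

(** * The plane and the model triangle *)

Section PlaneBasics.
Variable R : realType.
Local Notation C := (plane R).
Implicit Types (w x y z : C) (A : set C).

Lemma normc_geRe w : `|complex.Re w| <= normc w.
Proof. by case: w => a b /=; rewrite -sqrtr_sqr ler_wsqrtr // lerDl sqr_ge0. Qed.

Lemma normc_geIm w : `|complex.Im w| <= normc w.
Proof. by case: w => a b /=; rewrite -sqrtr_sqr ler_wsqrtr // lerDr sqr_ge0. Qed.

Lemma normc_ge0 w : 0 <= normc w.
Proof. by case: w => a b /=; rewrite sqrtr_ge0. Qed.

Lemma normc_leD w : normc w <= `|complex.Re w| + `|complex.Im w|.
Proof.
case: w => a b /=; rewrite -[leRHS]ger0_norm ?addr_ge0 // -sqrtr_sqr ler_wsqrtr //.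
rewrite sqrrD !real_normK ?num_real //.
by rewrite lerD2r lerDl mulrn_wge0 // mulr_ge0.
Qed.

Lemma normc_real (a : R) : normc a%:C = `|a|.
Proof. by rewrite /= expr0n /= addr0 sqrtr_sqr. Qed.

Lemma dist_ge0 x y : 0 <= dist x y. Proof. exact: normc_ge0. Qed.

Lemma distxx x : dist x x = 0. Proof. by rewrite /dist subrr normc0. Qed.

Lemma dist_eq0 x y : dist x y = 0 -> x = y.
Proof. by move/eq0_normc/eqP; rewrite subr_eq0 => /eqP. Qed.

Lemma dist_sym x y : dist x y = dist y x.
Proof. by rewrite /dist -opprB (normcN (y - x)). Qed.

Lemma dist_triangle y x z : dist x z <= dist x y + dist y z.
Proof. by rewrite /dist (le_trans _ (le_normcD _ _)) // addrA subrK. Qed.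

Lemma dist_geRe x y : `|complex.Re x - complex.Re y| <= dist x y.
Proof. by have := normc_geRe (x - y); case: x y => ? ? [? ?]. Qed.

Lemma dist_geIm x y : `|complex.Im x - complex.Im y| <= dist x y.
Proof. by have := normc_geIm (x - y); case: x y => ? ? [? ?]. Qed.

(** Balls of [C] have radii in [C] itself; a positive radius has zero imaginary part, so real radii
    suffice. *)
Lemma nbhs_plane x A :
  nbhs x A <-> exists2 e : R, 0 < e & forall y, dist x y < e -> A y.
Proof.
split=> [/nbhs_ballP[[e e'] /= e0 he]|[e e0 he]].
  move: e0; rewrite ltcE /= => /andP[/eqP e'0 e0].
  exists e => // y xy; apply: he; rewrite -ball_normE /=.
  by rewrite /Num.norm /= -/(dist x y) e'0 ltcR.
apply/nbhs_ballP; exists e%:C; first by rewrite /= ltcR.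
move=> y; rewrite -ball_normE /= /Num.norm /= => h.
by apply: he; rewrite -ltcR.
Qed.

Lemma plane_hausdorff : hausdorff_space C.
Proof. exact: norm_hausdorff. Qed.

End PlaneBasics.

Section ModelTriangle.
Variable R : realType.
Local Notation C := (plane R).
Implicit Types w : C.

(** The base angles have tangent 1/3, so twice such an angle has cosine 4/5 and sine 3/5 and the
    second segment gets a rational direction. *)
Definition apex : C := (1 / 2) +i* (1 / 6).
Definition model_triangle : set C := triangle 0 1 apex.

Lemma model_triangleE w : model_triangle w <->
  [/\ 0 <= complex.Im w, 3 * complex.Im w <= complex.Re w &
      3 * complex.Im w <= 1 - complex.Re w].
Proof.
case: w => x y /=; split=> [[u] [v] [t] [u0 v0 t0 uvt [-> ->]]|[h1 h2 h3]].
  by rewrite /=; split; lra.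
exists (1 - x - 3 * y), (x - 3 * y), (6 * y); split; [lra|lra|lra|lra|].
apply/eqP; rewrite eq_complex /=; apply/andP; split; apply/eqP => /=; lra.
Qed.

Lemma model_interiorE w : interior model_triangle w <->
  [/\ 0 < complex.Im w, 3 * complex.Im w < complex.Re w &
      3 * complex.Im w < 1 - complex.Re w].
Proof.
split=> [/nbhs_plane[e e0 he]|[]]; last first.
  case: w => x y /= h1 h2 h3; apply/nbhs_plane.
  exists (Num.min y (Num.min ((x - 3 * y) / 4) ((1 - x - 3 * y) / 4))).
    by rewrite !lt_min; apply/and3P; split; lra.
  move=> [x' y']; rewrite !lt_min => /and3P[d1 d2 d3]; apply/model_triangleE => /=.
  have := dist_geRe (x +i* y) (x' +i* y'); have := dist_geIm (x +i* y) (x' +i* y').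
  move: d1 d2 d3; move: (dist _ _) => d /= d1 d2 d3.
  rewrite !ler_norml => /andP[? ?] /andP[? ?].
  split; lra.
have near (a b : R) : `|a| + `|b| < e -> model_triangle (w + (a +i* b)).
  move=> ab; apply: he; apply: le_lt_trans ab.
  by rewrite /dist opprD addNKr normcN (le_trans (normc_leD _)).
have := near 0 (- (e / 2)); have := near (e / 2) 0; have := near (- (e / 2)) 0.
rewrite !normrN normr0 ger0_norm; last lra.
rewrite addr0 add0r => /(_ ltac:(lra))/model_triangleE + /(_ ltac:(lra))/model_triangleE
  + /(_ ltac:(lra))/model_triangleE.
case: w {he near} => x y /= [? ? ?] [? ? ?] [? ? ?].
split; lra.
Qed.

Lemma closure_model_interior : closure (interior model_triangle) = model_triangle.
Proof.
apply/seteqP; split=> w.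
  move=> cl; apply/model_triangleE.
  have near (e : R) : 0 < e -> exists2 w', dist w w' < e & interior model_triangle w'.
    move=> e0; have [|w' [hw' h]] := cl [set w' | dist w w' < e].
      by apply/nbhs_plane; exists e.
    by exists w'.
  have le_eps (a : R) : (forall e : R, 0 < e -> a <= e) -> a <= 0.
    by move=> h; apply/ler_addgt0Pr => e /h; rewrite add0r.
  have ex3 (e : R) : 0 < e -> [/\ - complex.Im w <= e,
      3 * complex.Im w - complex.Re w <= e &
      3 * complex.Im w - (1 - complex.Re w) <= e].
    move=> e0; have [|w' d /model_interiorE[? ? ?]] := near (e / 4); first lra.
    have := dist_geRe w w'; have := dist_geIm w w'.
    rewrite !ler_norml => /andP[? ?] /andP[? ?].
    by split; lra.
  have h1 : - complex.Im w <= 0 by apply: le_eps => e /ex3[].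
  have h2 : 3 * complex.Im w - complex.Re w <= 0 by apply: le_eps => e /ex3[].
  have h3 : 3 * complex.Im w - (1 - complex.Re w) <= 0.
    by apply: le_eps => e /ex3[].
  by split; lra.
case: w => x y /model_triangleE /= [h1 h2 h3] B /nbhs_plane[e e0 hB].
(* [w] is moved by the fraction [d] of the way towards the interior point [1/2 + i/12]. *)
pose d := Num.min (e / 2) (1 / 2).
have d0 : 0 < d by rewrite lt_min; apply/andP; split; lra.
have [de d1] : d <= e / 2 /\ d <= 1 / 2 by rewrite !ge_min !lexx orbT.
exists ((x + d * (1 / 2 - x)) +i* (y + d * (1 / 12 - y))); split.
  by apply/model_interiorE => /=; split; nra.
apply: hB; rewrite /dist (le_lt_trans (normc_leD _)) //=.
have -> : x - (x + d * (1 / 2 - x)) = d * (x - 1 / 2) by ring.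
have -> : y - (y + d * (1 / 12 - y)) = d * (y - 1 / 12) by ring.
rewrite !normrM (ger0_norm (ltW d0)) -mulrDr.
have : `|x - 1 / 2| + `|y - 1 / 12| <= 1.
  apply: (@le_trans _ _ (1 / 2 + 1 / 2)); last by lra.
  by rewrite lerD // ler_norml; apply/andP; split; lra.
nra.
Qed.

End ModelTriangle.

(** * Self-similar curves *)

Section GeometricLimits.
Variable R : realType.
Variables (D rho : R).
Hypothesis rho01 : 0 <= rho < 1.

(** With [c] the tail of the geometric series, [u - c] increases and [u + c] decreases; the limit is
    the supremum of the former. *)
Lemma geometric_limit (u : nat -> R) :
  (forall n, `|u n.+1 - u n| <= D * rho ^+ n) ->
  exists l, forall n, `|l - u n| <= D / (1 - rho) * rho ^+ n.
Proof.
move=> hu; have /andP[r0 r1] := rho01.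
have D0 : 0 <= D by have := hu 0%N; rewrite expr0 mulr1; apply: le_trans.
pose c n := D / (1 - rho) * rho ^+ n.
have c0 n : 0 <= c n by rewrite mulr_ge0 ?exprn_ge0 // divr_ge0 //; lra.
have cS n : c n - c n.+1 = D * rho ^+ n by rewrite /c exprS; field; lra.
have step i d : u i - c i <= u (i + d)%N - c (i + d)%N /\
                u (i + d)%N + c (i + d)%N <= u i + c i.
  elim: d => [|d [IH1 IH2]]; first by rewrite addn0.
  have := hu (i + d)%N; rewrite -cS addnS ler_norml => /andP[? ?].
  by split; lra.
have le_uc i k : u i - c i <= u k + c k.
  have := c0 i; have := c0 k.
  by case: (leqP i k) => [/subnKC <-|/ltnW/subnKC <-];
    [have [] := step i (k - i)%N|have [] := step k (i - k)%N]; lra.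
exists (sup (range (fun n => u n - c n))) => n; rewrite ler_norml -/(c n).
have h1 : u n - c n <= sup (range (fun n => u n - c n)).
  apply: ub_le_sup; last by exists n.
  by exists (u 0%N + c 0%N) => _ [i _ <-].
have h2 : sup (range (fun n => u n - c n)) <= u n + c n.
  by apply: ge_sup; [exists (u 0%N - c 0%N), 0%N|move=> _ [i _ <-]].
by apply/andP; split; lra.
Qed.

Lemma geometric_le0 (x : R) : (forall n, x <= D * rho ^+ n) -> x <= 0.
Proof.
move=> hx; rewrite leNgt; apply/negP => x0.
have [D0|D0] := leP D 0; first by have := hx 0%N; rewrite expr0; lra.
have [|n hn] := exp_lt_exists rho01 (x := x / D); first by rewrite divr_gt0.
by have := hx n; rewrite ltr_pdivlMr // in hn; lra.
Qed.

End GeometricLimits.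

Lemma exp_gt_exists (R : realType) (l : nat) (x : R) :
  (1 < l)%N -> 0 < x -> exists n, 1 < x * l%:R ^+ n.
Proof.
move=> l1 x0; have L0 : 0 < l%:R :> R by rewrite ltr0n ltnW.
have [||n hn] := @exp_lt_exists R l%:R^-1 x; last 1 first.
- exists n; move: hn; rewrite exprVn -ltr_pdivrMr ?invr_gt0 ?exprn_gt0 //.
  by rewrite div1r.
- by rewrite invr_ge0 ltW //= invf_lt1 // ltr1n.
- by [].
Qed.

(** * Digits of a parameter in base [l] *)

Section Digits.
Variables (R : realType) (l : nat).
Hypothesis l_gt0 : (0 < l)%N.

(** Clipping at [l.-1] gives [t = 1] the last digit and the shift 1, so that [shift] preserves the
    closed unit interval. *)
Definition digit (t : R) : nat := minn l.-1 (Num.truncn (l%:R * t)).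
Definition shift (t : R) : R := l%:R * t - (digit t)%:R.

Let L0 : 0 < l%:R :> R. Proof. by rewrite ltr0n. Qed.

Lemma digit_shift t : t = ((digit t)%:R + shift t) / l%:R.
Proof. by rewrite /shift; field; rewrite gt_eqF. Qed.

Lemma digitP t : 0 <= t <= 1 -> (digit t < l)%N /\ 0 <= shift t <= 1.
Proof.
move=> /andP[t0 t1].
have lt0 : 0 <= l%:R * t by rewrite mulr_ge0 // ltW.
have lt1 : l%:R * t <= l%:R by rewrite ger_pMr.
split; first by rewrite /digit; lia.
have /andP[h1 h2] := truncn_itv lt0; rewrite /shift /digit.
rewrite /minn; case: ltnP => h; last by rewrite -natr1 in h2; apply/andP; split; lra.
have e : l%:R = l.-1%:R + 1 :> R by rewrite natr1 prednK.
have : l.-1.+1%:R <= l%:R * t by rewrite (le_trans _ h1) // ler_nat.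
by rewrite -natr1 => ?; apply/andP; split; lra.
Qed.

Lemma digitE j s : (j < l)%N -> 0 <= s < 1 ->
  digit ((j%:R + s) / l%:R) = j /\ shift ((j%:R + s) / l%:R) = s.
Proof.
move=> jl /andP[s0 s1].
have e : l%:R * ((j%:R + s) / l%:R) = j%:R + s by field; rewrite gt_eqF.
have d : digit ((j%:R + s) / l%:R) = j.
  rewrite /digit e (@truncn_def _ _ j); first by lia.
  by rewrite -natr1; apply/andP; split; lra.
by split=> //; rewrite /shift d e addrC addKr.
Qed.

Lemma digit1 : digit 1 = l.-1 /\ shift 1 = 1.
Proof.
have d : digit 1 = l.-1 by rewrite /digit mulr1 natrK; lia.
by split=> //; rewrite /shift d mulr1 -{1}(prednK l_gt0) -natr1 addrC addKr.
Qed.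

Lemma digit_le s t : s <= t -> (digit s <= digit t)%N.
Proof.
move=> st; have : (Num.truncn (l%:R * s) <= Num.truncn (l%:R * t))%N.
  by apply: le_truncn; rewrite ler_wpM2l // ltW.
by rewrite /digit; move: (Num.truncn _) (Num.truncn _) => a b; lia.
Qed.

End Digits.

(** * The parametrized attractor of a family of similitudes *)

Section Curve.
Variable R : realType.
Local Notation C := (plane R).
Variables (l : nat) (z : nat -> C) (rho : R).
Hypothesis l_gt0 : (0 < l)%N.
Hypothesis z_first : z 0%N = 0.
Hypothesis z_last : z l = 1.
Hypothesis rho01 : 0 <= rho < 1.
Hypothesis ratio : forall j, (j < l)%N -> normc (z j.+1 - z j) <= rho.

(** Numbered from 0: when the polygon runs from 0 to 1, [piece j] is its similitude [S_(j+1)]. *)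
Definition piece (j : nat) (w : C) : C := z j + (z j.+1 - z j) * w.

Lemma simil_piece j w : simil l z j.+1 w = piece j w.
Proof. by rewrite /simil /piece /= z_first z_last !subr0 divr1. Qed.

Lemma dist_piece j w w' :
  dist (piece j w) (piece j w') = normc (z j.+1 - z j) * dist w w'.
Proof.
rewrite /dist /piece -normcM; congr normc; ring.
Qed.

Lemma dist_piece_le j w w' : (j < l)%N ->
  dist (piece j w) (piece j w') <= rho * dist w w'.
Proof. by move=> jl; rewrite dist_piece ler_wpM2r ?dist_ge0 // ratio. Qed.

Local Notation digit := (@digit R l).
Local Notation shift := (@shift R l).

Let L0 : 0 < l%:R :> R. Proof. by rewrite ltr0n. Qed.

(** Iterates, started at the straight path, of the [rho]-contracting operator whose fixed point is
    the self-similar curve. *)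
Fixpoint approx (n : nat) (t : R) : C :=
  if n is m.+1 then piece (digit t) (approx m (shift t)) else t%:C.

Lemma approx_step : exists D, forall n t, 0 <= t <= 1 ->
  dist (approx n.+1 t) (approx n t) <= D * rho ^+ n.
Proof.
have /andP[r0 r1] := rho01.
exists (\sum_(j < l) normc (z j) + 2); elim=> [|n IH] t t01.
  have [dl s01] := digitP l_gt0 t01; rewrite expr0 mulr1 /= /dist /piece.
  rewrite (le_trans (le_normcD _ _)) // normcN normc_real.
  rewrite (le_trans (lerD (le_normcD _ _) (lexx _))) // normcM normc_real.
  rewrite (bigD1 (Ordinal dl)) //=.
  have := ratio dl; set a := normc _ => ha.
  have : 0 <= \sum_(i < l | i != Ordinal dl) normc (z i).
    by apply: sumr_ge0 => i _; exact: normc_ge0.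
  have a0 : 0 <= a := normc_ge0 _.
  move: s01 t01; set s := shift t => s01 /andP[t0 t1]; have [s0 s1] := andP s01.
  rewrite !ger0_norm //; nra.
have [dl s01] := digitP l_gt0 t01.
rewrite [approx n.+2 t]/= [approx n.+1 t]/= (le_trans (dist_piece_le _ _ dl)) //.
by rewrite exprS mulrCA ler_wpM2l // -/(approx n.+1 _) IH.
Qed.

Lemma curve_exists : exists (f : R -> C) (K : R), forall n t, 0 <= t <= 1 ->
  dist (f t) (approx n t) <= K * rho ^+ n.
Proof.
have [D hD] := approx_step.
have lim t : exists w : C, 0 <= t <= 1 -> forall n,
    dist w (approx n t) <= (2 * (D / (1 - rho))) * rho ^+ n.
  case: (boolP (0 <= t <= 1)) => t01; last by exists 0.
  have [n|x hx] := @geometric_limit _ D rho rho01 (fun n => complex.Re (approx n t)).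
    exact: le_trans (dist_geRe _ _) (hD _ _ t01).
  have [n|y hy] := @geometric_limit _ D rho rho01 (fun n => complex.Im (approx n t)).
    exact: le_trans (dist_geIm _ _) (hD _ _ t01).
  exists (x +i* y) => _ n; rewrite /dist (le_trans (normc_leD _)) //.
  move: (hx n) (hy n); case: (approx n t) => a b /= h1 h2; lra.
have [f hf] := choice lim.
by exists f, (2 * (D / (1 - rho))) => n t t01; exact: hf.
Qed.

(** The functional equation passes to the limit of [approx]. The last conclusion is an invariance
    principle: a closed set that contains the segment and is stable under the pieces contains every
    approximation, hence the curve. *)
Lemma self_similar_curve : exists f : R -> C,
  [/\ f 0 = 0, f 1 = 1,
      (forall j s, (j < l)%N -> 0 <= s <= 1 ->
         f ((j%:R + s) / l%:R) = piece j (f s)),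
      (exists M, forall t, 0 <= t <= 1 -> normc (f t) <= M) &
      forall A : set C, closed A -> (forall t, 0 <= t <= 1 -> A t%:C) ->
        (forall j w, (j < l)%N -> A w -> A (piece j w)) ->
        forall t, 0 <= t <= 1 -> A (f t)].
Proof.
have /andP[r0 r1] := rho01.
have [f [K hf]] := curve_exists.
have fE t : 0 <= t <= 1 -> f t = piece (digit t) (f (shift t)).
  move=> t01; have [dl s01] := digitP l_gt0 t01; apply: dist_eq0; apply/eqP.
  rewrite eq_le dist_ge0 andbT; apply: (@geometric_le0 _ (2 * K * rho) rho rho01) => n.
  rewrite (le_trans (dist_triangle (approx n.+1 t) _ _)) //.
  have := hf n.+1 t t01; have := hf n _ s01; rewrite exprS.
  have := dist_piece_le (approx n (shift t)) (f (shift t)) dl.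
  rewrite -[piece _ (approx _ _)]/(approx n.+1 t) (dist_sym (approx n _)).
  move: (dist _ _) (dist _ _) (dist _ _) => a b c h1 h2 h3.
  by have : rho * b <= rho * (K * rho ^+ n); [rewrite ler_wpM2l|lra].
have itv0 : (0 <= (0 : R)) && ((0 : R) <= 1) by rewrite lexx ler01.
have f0 : f 0 = 0.
  have [d s] : digit 0 = 0%N /\ shift 0 = 0.
    have h0 : (0 <= (0 : R)) && ((0 : R) < 1) by rewrite lexx ltr01.
    by have := digitE l_gt0 l_gt0 h0; rewrite addr0 mul0r.
  have := fE 0 itv0; rewrite d s /piece z_first add0r subr0 => e.
  have := ratio l_gt0; rewrite z_first subr0 => hz.
  apply: eq0_normc; move/(congr1 (@normc R)): e; rewrite normcM.
  have := normc_ge0 (f 0); nra.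
have f1 : f 1 = 1.
  have [d s] := digit1 R l_gt0.
  have := fE 1; rewrite d s ler01 lexx /piece prednK // z_last => /(_ isT) e.
  have := @ratio l.-1; rewrite prednK // leqnn z_last => /(_ isT) hz.
  apply: dist_eq0; move: e; rewrite /dist => e.
  have : f 1 - 1 = (1 - z l.-1) * (f 1 - 1) by rewrite {1}e; ring.
  move=> /(congr1 (@normc R)); rewrite normcM.
  have := normc_ge0 (f 1 - 1); nra.
exists f; split=> //.
- move=> j s jl /andP[s0 s1].
  have t0 : 0 <= (j%:R + s) / l%:R by rewrite divr_ge0 ?(ltW L0) // addr_ge0.
  have t1 : (j%:R + s) / l%:R <= 1.
    by rewrite ler_pdivrMr // mul1r; move: jl; rewrite -(ler_nat R) -natr1; lra.
  have [s1'|s1'] := ltP s 1.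
    have [d e] := digitE l_gt0 jl (introT andP (conj s0 s1')).
    by rewrite fE ?t0 ?t1 // d e.
  (* Here the parameter is [(j + 1) / l]; unless it is 1, its digit is [j + 1], so the value is read
     off the next piece, which agrees at the common vertex. *)
  have -> : s = 1 by apply/eqP; rewrite eq_le s1.
  rewrite natr1 f1 /piece mulr1 addrC subrK.
  have [jl1|] := ltnP j.+1 l.
    have [d e] := digitE l_gt0 jl1 (introT andP (conj (lexx (0 : R)) ltr01)).
    rewrite addr0 in d e; rewrite fE; first by rewrite d e f0 /piece mulr0 addr0.
    by rewrite divr_ge0 ?(ltW L0) //= ler_pdivrMr // mul1r ler_nat ltnW.
  move=> lj; have -> : j.+1 = l by apply/eqP; rewrite eqn_leq lj andbT.
  by rewrite divff ?gt_eqF // f1 z_last.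
- exists (1 + K) => t t01; have := hf 0%N t t01; rewrite expr0 mulr1 /=.
  have := dist_triangle t%:C (f t) 0; rewrite /dist !subr0 normc_real.
  by move: t01 => /andP[t0 t1]; rewrite ger0_norm //; lra.
- move=> A clA A0 Apiece.
  have Aapprox n : forall t, 0 <= t <= 1 -> A (approx n t).
    elim: n => [|n IH] t t01; first exact: A0.
    have [dl s01] := digitP l_gt0 t01; apply: Apiece => //; exact: IH.
  move=> t t01; apply: clA => B /nbhs_plane[e e0 hB].
  have [K0|K0] := leP K 0.
    exists (approx 0 t); split; first exact: Aapprox.
    by apply: hB; have := hf 0%N t t01; rewrite expr0; lra.
  have [|n hn] := exp_lt_exists rho01 (x := e / K); first by rewrite divr_gt0.
  exists (approx n t); split; first exact: Aapprox.
  apply: hB; rewrite (le_lt_trans (hf n _ t01)) //.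
  by rewrite ltr_pdivlMr // in hn; lra.
Qed.

(** * Continuity, injectivity and reduction to different pieces by rescaling *)

Section Continuity.
Variable f : R -> C.
Hypothesis f_piece : forall j s, (j < l)%N -> 0 <= s <= 1 ->
  f ((j%:R + s) / l%:R) = piece j (f s).
Hypothesis f_bounded : exists M, forall t, 0 <= t <= 1 -> normc (f t) <= M.

Lemma curve_digit t : 0 <= t <= 1 -> f t = piece (digit t) (f (shift t)).
Proof. by move=> /(digitP l_gt0)[dl s01]; rewrite -f_piece // -digit_shift. Qed.

(** Each digit shared by the two parameters gains a factor [rho]. When they fall into adjacent
    pieces, the estimate goes through the common vertex, using one-sided bounds at 0 and 1. *)
Lemma curve_modulus : exists M, forall n s t, 0 <= s <= 1 -> 0 <= t <= 1 ->
  `|s - t| * l%:R ^+ n <= 1 -> dist (f s) (f t) <= M * rho ^+ n.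
Proof.
have /andP[r0 r1] := rho01.
have [M hM] := f_bounded; pose M1 := M + 1.
have M0 : 0 <= M by rewrite (le_trans (normc_ge0 _) (hM 0 _)) // lexx ler01.
have end0 n t : 0 <= t <= 1 -> t * l%:R ^+ n <= 1 -> dist (f t) 0 <= M1 * rho ^+ n.
  elim: n t => [|n IH] t t01 tn.
    by rewrite expr0 /dist subr0; have := hM _ t01; rewrite /M1; lra.
  have [t0 t1] := andP t01.
  have lt1 : 0 <= l%:R * t <= 1.
    have l1 : 1 <= l%:R ^+ n :> R by rewrite exprn_ege1 // ler1n.
    have lt0 : 0 <= l%:R * t by rewrite mulr_ge0 // ltW.
    by rewrite lt0; move: tn; rewrite exprS; nra.
  have -> : f t = piece 0 (f (l%:R * t)).
    rewrite -f_piece //; congr f; field; exact: lt0r_neq0.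
  have -> : 0 = piece 0 0 :> C by rewrite /piece z_first mulr0 addr0.
  rewrite (le_trans (dist_piece_le _ _ l_gt0)) // exprS mulrCA ler_wpM2l // IH //.
  by rewrite mulrAC -exprS mulrC.
have end1 n t : 0 <= t <= 1 -> (1 - t) * l%:R ^+ n <= 1 -> dist (f t) 1 <= M1 * rho ^+ n.
  elim: n t => [|n IH] t t01 tn.
    rewrite expr0 /dist (le_trans (le_normcD _ _)) // normcN normc1.
    by have := hM _ t01; rewrite /M1; lra.
  have [t0 t1] := andP t01.
  have lt1 : 0 <= 1 - l%:R * (1 - t) <= 1.
    have l1 : 1 <= l%:R ^+ n :> R by rewrite exprn_ege1 // ler1n.
    have lt0 : 0 <= l%:R * (1 - t) by rewrite mulr_ge0 ?subr_ge0 // ltW.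
    by move: tn; rewrite exprS; nra.
  have ll : (l.-1 < l)%N by rewrite prednK.
  have e : l%:R = l.-1%:R + 1 :> R by rewrite natr1 prednK.
  have -> : f t = piece l.-1 (f (1 - l%:R * (1 - t))).
    rewrite -f_piece //; congr f; field: e; exact: lt0r_neq0.
  have -> : 1 = piece l.-1 1 :> C.
    by rewrite /piece prednK // z_last mulr1 addrC subrK.
  rewrite (le_trans (dist_piece_le _ _ ll)) // exprS mulrCA ler_wpM2l // IH //.
  by rewrite opprB addrC subrK mulrAC -exprS mulrC.
exists (2 * M1); elim=> [|n IH].
  move=> s t s01 t01 _; rewrite /dist (le_trans (le_normcD _ _)) // normcN expr0.
  by have := hM _ t01; have := hM _ s01; rewrite /M1; lra.
suff wlog_le s t : 0 <= s <= 1 -> 0 <= t <= 1 -> s <= t ->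
    (t - s) * l%:R ^+ n.+1 <= 1 -> dist (f s) (f t) <= 2 * M1 * rho ^+ n.+1.
  move=> s t s01 t01; have [st|/ltW ts] := leP s t.
    by rewrite distrC ger0_norm ?subr_ge0 //; exact: wlog_le.
  by rewrite ger0_norm ?subr_ge0 // dist_sym; exact: wlog_le.
move=> s01 t01 st; rewrite exprS mulrA => hst.
have [il /andP[s0 s1]] := digitP l_gt0 s01; have es := digit_shift l_gt0 s.
move: (digit s) (shift s) il s0 s1 es => i s' il s0 s1 es.
have [t0 t1] := andP t01.
have ln1 : 1 <= l%:R ^+ n :> R by rewrite exprn_ege1 // ler1n.
(* This is [t] in the coordinate of the piece of [s]. It is at most 2, so beyond 1 it lies in the
   next piece. *)
pose t' := l%:R * t - i%:R.
have et : t = (i%:R + t') / l%:R by rewrite /t'; field; exact: lt0r_neq0.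
have est : (t - s) * l%:R = t' - s' by rewrite {1}et es; field; exact: lt0r_neq0.
rewrite est in hst.
have st' : s' <= t' by rewrite -subr_ge0 -est mulr_ge0 ?subr_ge0 // ltW.
have ts1 : t' - s' <= 1 by nra.
have fs : f s = piece i (f s') by rewrite es f_piece // s0.
have [t1'|t1'] := leP t' 1.
  have t0' : 0 <= t' by lra.
  have -> : f t = piece i (f t') by rewrite et f_piece // t0'.
  rewrite fs (le_trans (dist_piece_le _ _ il)) // exprS mulrCA ler_wpM2l //.
  apply: IH; rewrite ?s0 ?t0' //.
  by rewrite distrC ger0_norm // subr_ge0.
have il1 : (i.+1 < l)%N.
  rewrite -(ltr_nat R) -natr1.
  by have : l%:R * t <= l%:R by [rewrite ger_pMr]; rewrite /t' in t1'; lra.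
have ft : f t = piece i.+1 (f (t' - 1)).
  by rewrite et -(f_piece il1); [congr f; rewrite -natr1; field; exact: lt0r_neq0|lra].
rewrite fs ft (le_trans (dist_triangle (z i.+1) _ _)) //.
have -> : 2 * M1 * rho ^+ n.+1 = rho * (M1 * rho ^+ n) + rho * (M1 * rho ^+ n).
  by rewrite exprS; ring.
apply: lerD.
  have {1}-> : z i.+1 = piece i 1 by rewrite /piece mulr1 addrC subrK.
  rewrite (le_trans (dist_piece_le _ _ il)) // ler_wpM2l //.
  by apply: end1; [rewrite s0|nra].
have {1}-> : z i.+1 = piece i.+1 0 by rewrite /piece mulr0 addr0.
rewrite (le_trans (dist_piece_le _ _ il1)) // ler_wpM2l // dist_sym.
by apply: end0; [lra|nra].
Qed.

Lemma curve_continuous : {within `[0, 1], continuous f}.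
Proof.
have [M hM] := curve_modulus.
apply/subspace_continuousP => x x01 B /nbhs_plane[e e0 hB].
have [n hn] : exists n, M * rho ^+ n < e.
  have [M0|M0] := leP M 0; first by exists 0%N; rewrite expr0; lra.
  have [|n hn] := exp_lt_exists rho01 (x := e / M); first by rewrite divr_gt0.
  by exists n; rewrite ltr_pdivlMr // in hn; lra.
have ln0 : 0 < l%:R ^+ n :> R by rewrite exprn_gt0.
apply/nbhs_ballP; exists (l%:R ^- n) => /=; first by rewrite invr_gt0.
move=> y; rewrite -ball_normE /= => xy y01; apply: hB.
rewrite (le_lt_trans (hM n _ _ x01 y01 _)) //.
by rewrite -ler_pdivlMr // mul1r ltW.
Qed.

(** Stripping a common digit from two parameters with the same image multiplies their distance by
    [l], which cannot go on forever; in different pieces only the common vertex is left. *)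
Lemma curve_injective : (1 < l)%N ->
  (forall j, (j < l)%N -> z j.+1 != z j) ->
  (forall i j s t, (i < j)%N -> (j < l)%N -> 0 <= s <= 1 -> 0 <= t <= 1 ->
     piece i (f s) = piece j (f t) -> [/\ j = i.+1, s = 1 & t = 0]) ->
  forall s t, 0 <= s <= 1 -> 0 <= t <= 1 -> f s = f t -> s = t.
Proof.
move=> l1 zS sep.
have sep_eq s t : 0 <= s <= 1 -> 0 <= t <= 1 -> f s = f t ->
    (digit s < digit t)%N -> s = t.
  move=> s01 t01; rewrite (curve_digit s01) (curve_digit t01) => e ij.
  have [_ hs] := digitP l_gt0 s01; have [hj ht] := digitP l_gt0 t01.
  have [ej es et] := sep _ _ _ _ ij hj hs ht e.
  rewrite (digit_shift l_gt0 s) (digit_shift l_gt0 t) es et ej -natr1; congr (_ / _); ring.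
have scale n : forall s t, 0 <= s <= 1 -> 0 <= t <= 1 -> f s = f t ->
    `|s - t| * l%:R ^+ n <= 1.
  elim: n => [|n IH] s t s01 t01 fst.
    by rewrite expr0 mulr1 ler_norml; lra.
  have [ij|ji|ij] := ltngtP (digit s) (digit t).
  - by rewrite (sep_eq s t) // subrr normr0 mul0r.
  - by rewrite (sep_eq t s) // subrr normr0 mul0r.
  have [hi hs] := digitP l_gt0 s01; have [_ ht] := digitP l_gt0 t01.
  have fst' : f (shift s) = f (shift t).
    move: fst; rewrite (curve_digit s01) (curve_digit t01) -ij /piece.
    by move/addrI/mulfI; apply; rewrite subr_eq0 zS.
  have -> : s - t = (shift s - shift t) / l%:R.
    by rewrite {1}(digit_shift l_gt0 s) {1}(digit_shift l_gt0 t) ij; field; exact: lt0r_neq0.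
  rewrite normrM (gtr0_norm (x := l%:R^-1)) ?invr_gt0 // exprS mulrA divfK ?gt_eqF //.
  exact: IH.
move=> s t s01 t01 fst; apply/eqP; rewrite -subr_eq0 -normr_le0 leNgt.
apply/negP => /(exp_gt_exists l1)[n]; apply/negP; rewrite -leNgt; exact: scale.
Qed.

(* As [t >= 1], passing to a smaller copy only improves the inequality, so it
   suffices to treat endpoints lying in different pieces. *)
Lemma curve_quasi_arc_pieces (t M : R) : (1 < l)%N -> 1 <= t ->
  (forall j, (j < l)%N -> z j.+1 != z j) -> 0 <= M ->
  (forall i j s u p q, (i < j)%N -> (j < l)%N -> 0 <= s <= 1 -> 0 <= u <= 1 ->
     (i%:R + s) / l%:R <= p <= (j%:R + u) / l%:R ->
     (i%:R + s) / l%:R <= q <= (j%:R + u) / l%:R ->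
     dist (f p) (f q) `^ t <= M * dist (piece i (f s)) (piece j (f u))) ->
  forall x y p q, 0 <= x -> y <= 1 -> x <= p <= y -> x <= q <= y ->
    dist (f p) (f q) `^ t <= M * dist (f x) (f y).
Proof.
move=> l1 t1 zS M0 hM.
have scale n : forall x y p q, 0 <= x -> y <= 1 -> 1 < (y - x) * l%:R ^+ n ->
    x <= p <= y -> x <= q <= y -> dist (f p) (f q) `^ t <= M * dist (f x) (f y).
  elim: n => [|n IH] x y p q x0 y1.
    by rewrite expr0; lra.
  move=> hn hp hq.
  have x01 : 0 <= x <= 1 by lra.
  have y01 : 0 <= y <= 1 by lra.
  have xy : x <= y by lra.
  have [hi hs] := digitP l_gt0 x01; have [hj hu] := digitP l_gt0 y01.
  rewrite (curve_digit x01) (curve_digit y01).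
  have := digit_le l_gt0 xy; rewrite leq_eqVlt => /predU1P[ij|ij]; last first.
    by apply: hM => //; rewrite -!digit_shift.
  rewrite -ij; have sub v : x <= v <= y -> exists2 w, shift x <= w <= shift y &
      f v = piece (digit x) (f w).
    move=> hv; exists (l%:R * v - (digit x)%:R).
      by rewrite /shift -ij !lerD2r !ler_pM2l.
    have hw : 0 <= l%:R * v - (digit x)%:R <= 1.
      have : shift x <= l%:R * v - (digit x)%:R <= shift y.
        by rewrite /shift -ij !lerD2r !ler_pM2l.
      lra.
    by rewrite -f_piece //; congr f; field; exact: lt0r_neq0.
  have [p' hp' ->] := sub _ hp; have [q' hq' ->] := sub _ hq.
  rewrite !dist_piece; set r := normc _.
  have r0 : 0 < r.
    by rewrite lt_neqAle normc_ge0 andbT eq_sym; apply/eqP => /eq0_normc/eqP;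
      rewrite subr_eq0; apply/negP/zS.
  have r1 : r <= 1 by rewrite (le_trans (ratio hi)) // ltW //; case/andP: rho01.
  rewrite powRM ?dist_ge0 ?(ltW r0) // mulrCA.
  apply: ler_pM; rewrite ?powR_ge0 //.
    by apply: ge1r_powR => //; rewrite r0.
  apply: IH => //; [lra|lra|].
  apply: (lt_le_trans hn); rewrite exprS mulrA ler_wpM2r ?exprn_ge0 ?(ltW L0) //.
  by rewrite /shift -ij; lra.
move=> x y p q x0 y1 hp hq.
have [yx|xy] := leP y x.
  have -> : p = x by lra.
  have -> : q = x by lra.
  by rewrite distxx powR0 ?mulr_ge0 ?dist_ge0 // gt_eqF //; lra.
have [|n hn] := exp_gt_exists l1 (x := y - x); first by rewrite subr_gt0.
exact: (scale n).
Qed.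

End Continuity.
End Curve.

(** * Arcs and subarcs *)

Section Arcs.
Variable R : realType.
Local Notation C := (plane R).
Implicit Types (L : set C) (f : R -> C) (g : C -> R).

Lemma diam_le (A : set C) (D : R) : A !=set0 ->
  (forall p q, A p -> A q -> dist p q <= D) -> diam A <= D.
Proof.
move=> [a Aa] hD; apply: ge_sup; first by exists (dist a a), a => //; exists a.
by move=> _ [p hp [q hq <-]]; exact: hD.
Qed.

Lemma diam_ge (A : set C) (D : R) p q :
  (forall x y, A x -> A y -> dist x y <= D) ->
  A p -> A q -> dist p q <= diam A.
Proof.
move=> hD Ap Aq; apply: ub_le_sup; last by exists p => //; exists q.
by exists D => _ [x Ax [y Ay <-]]; exact: hD.
Qed.

(** A continuous injection of a compact set into a Hausdorff space maps closed sets to closed sets,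
    so its inverse is continuous. *)
Lemma injective_arc_param f : {within `[0, 1], continuous f} ->
  {in `[0, 1]%classic &, injective f} -> exists g, arc_param (f @` `[0, 1]) f g.
Proof.
move=> cf injf.
pose g p := xget 0 [set t | `[0, 1]%classic t /\ f t = p].
have gP p : (f @` `[0, 1]) p -> `[0, 1]%classic (g p) /\ f (g p) = p.
  move=> [t t01 ftp]; rewrite /g.
  by apply: (@xgetPex _ 0 [set t | `[0, 1]%classic t /\ f t = p]); exists t.
have gf t : `[0, 1]%classic t -> g (f t) = t.
  move=> t01; have [|g01 e] := gP (f t); first by exists t.
  by apply: injf e; rewrite inE.
exists g; split => //.
- by split=> [t t01|p /gP[]//]; exists t.
- by move=> p /gP[].
apply/subspace_continuousP => x Lx B /nbhs_ballP[e /= e0 hB].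
pose K := `[0, 1]%classic `&` ~` ball (g x) e.
have cK : compact K.
  apply: compact_closedI; first exact: segment_compact.
  by apply: open_closedC; exact: ball_open.
have cfK : closed (f @` K).
  apply: compact_closed; first exact: plane_hausdorff.
  apply: continuous_compact cK; apply: continuous_subspaceW cf.
  exact: subIsetl.
have : nbhs x (~` (f @` K)).
  apply: open_nbhs_nbhs; split; first exact: closed_openC.
  move=> [t [t01 tB] e1]; apply: tB; rewrite -e1 gf //.
  exact: ballxx.
apply: filterS => y yK Ly; apply: hB; apply: contrapT => h.
by apply: yK; exists (g y); [split=> //; exact: (gP y Ly).1|exact: (gP y Ly).2].
Qed.

(** The change of parameter [g \o f'] is continuous and injective on an interval, hence monotone,
    and either direction preserves betweenness. *)
Lemma subarcE L f g x y : arc_param L f g -> L x -> L y ->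
  subarc L x y =
    [set p | L p /\ Num.min (g x) (g y) <= g p <= Num.max (g x) (g y)].
Proof.
move=> fg Lx Ly; apply/seteqP; split=> p; last by move=> [Lp hp]; exists f, g.
move=> [f' [g' [fg' Lp hp]]]; split=> //.
have [[fL gL] gf fgK cf cg] := fg; have [[fL' gL'] gf' fgK' cf' cg'] := fg'.
have inj : {in `[0, 1] &, injective (g \o f')}.
  move=> s t s01 t01 /= /(congr1 f); rewrite !fgK; [|exact: fL'|exact: fL'].
  by move=> /(congr1 g'); rewrite !gf'.
have cont : {within `[0, 1], continuous (g \o f')}.
  apply/subspace_continuousP => t t01.
  move/subspace_continuousP: cf' => /(_ t t01) cf't.
  move/subspace_continuousP: cg => /(_ (f' t) (fL' t t01)) cgt.
  apply: cvg_comp cgt => B /= hB.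
  have := cf't _ hB; rewrite /nbhs /= /within /= .
  by apply: filterS => s hs s01; exact: hs s01 (fL' _ s01).
have gE q : L q -> g q = (g \o f') (g' q) by move=> Lq /=; rewrite fgK'.
rewrite (gE x) // (gE y) // (gE p) //.
move: (gL' _ Lx) (gL' _ Ly) (gL' _ Lp) hp; set h := g \o f'.
move: (g' x) (g' y) (g' p) => a b c a01 b01 c01.
have [mono|mono] := itv_continuous_inj_mono cont inj.
- have le : {in `[0, 1] &, {homo h : u v / u <= v}}.
    move=> u v u01 v01; rewrite le_eqVlt => /predU1P[->//|uv].
    exact/ltW/mono.
  rewrite ge_min le_max => /andP[/orP h1 /orP h2].
  rewrite ge_min le_max; apply/andP; split; apply/orP.
    by case: h1 => h1; [left|right]; apply: le.
  by case: h2 => h2; [left|right]; apply: le.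
- have le : {in `[0, 1] &, forall u v, u <= v -> h v <= h u}.
    move=> u v u01 v01; rewrite le_eqVlt => /predU1P[->//|uv].
    exact/ltW/mono.
  rewrite ge_min le_max => /andP[/orP h1 /orP h2].
  rewrite ge_min le_max; apply/andP; split; apply/orP.
    by case: h2 => h2; [left|right]; apply: le.
  by case: h1 => h1; [left|right]; apply: le.
Qed.

Variables (f : R -> C) (g : C -> R).
Local Notation L := (f @` `[0, 1]).
Hypothesis fg : arc_param L f g.
Variable t : R.

Let L_f s : 0 <= s <= 1 -> L (f s).
Proof. by move=> s01; exists s. Qed.

Let gf s : 0 <= s <= 1 -> g (f s) = s.
Proof. by case: fg => _ + _ _ _; apply. Qed.

Let subarc_f x y p : 0 <= x -> x <= y -> y <= 1 ->
  subarc L (f x) (f y) p <-> exists2 s, x <= s <= y & p = f s.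
Proof.
move=> x0 xy y1; have x01 : 0 <= x <= 1 by lra.
have y01 : 0 <= y <= 1 by lra.
rewrite (subarcE fg (L_f x01) (L_f y01)) /= !gf // (min_idPl xy) (max_idPr xy).
split=> [[[s s01 <-]]|[s /andP[xs sy] ->]]; first by rewrite gf // => h; exists s.
have s01 : 0 <= s <= 1 by lra.
by rewrite gf //; split; [exact: L_f|rewrite xs sy].
Qed.

Lemma quasi_arc_curve (M : R) : 0 < t -> 0 < M ->
  (forall x y p q, 0 <= x -> y <= 1 -> x <= p <= y -> x <= q <= y ->
     dist (f p) (f q) `^ t <= M * dist (f x) (f y)) ->
  quasi_arc t L.
Proof.
move=> t0 M0 hM; exists M => // _ _ [x x01 <-] [y y01 <-].
wlog xy : x y x01 y01 / x <= y => [hw|].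
  have [|/ltW yx] := leP x y; first exact: hw.
  rewrite dist_sym (_ : subarc _ _ _ = subarc L (f y) (f x)) ?hw //.
  rewrite !(subarcE fg) //; try exact: L_f.
  by apply/seteqP; split=> p /=; rewrite minC maxC.
have [x0 x1] := andP x01; have [y0 y1] := andP y01.
(* The [t]-th root of the required bound: it bounds the diameter before the power is taken. *)
pose D := (M * dist (f x) (f y)) `^ t^-1.
have MD0 : 0 <= M * dist (f x) (f y) by rewrite mulr_ge0 ?dist_ge0 // ltW.
have DE : D `^ t = M * dist (f x) (f y).
  by rewrite -powRrM mulVf ?gt_eqF // powRr1.
have ne : subarc L (f x) (f y) (f x) by apply/subarc_f => //; exists x; rewrite ?lexx.
have leD p q : subarc L (f x) (f y) p -> subarc L (f x) (f y) q -> dist p q <= D.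
  move=> /(subarc_f _ x0 xy y1)[p' hp ->] /(subarc_f _ x0 xy y1)[q' hq ->].
  rewrite leNgt; apply/negP => /(gt0_ltr_powR t0).
  rewrite !nnegrE => /(_ (powR_ge0 _ _) (dist_ge0 _ _)).
  by rewrite ltNge DE hM.
rewrite -DE; apply: ge0_ler_powR; rewrite ?nnegrE ?powR_ge0 ?(ltW t0) //.
  by rewrite (le_trans _ (diam_ge leD ne ne)) // dist_ge0.
by apply: diam_le => //; exists (f x).
Qed.

Lemma curve_quasi_arc (K : R) : 0 <= t ->
  (forall s, 0 <= s <= 1 -> normc (f s) <= K) -> quasi_arc t L ->
  exists2 M : R, 0 < M & forall x p y, 0 <= x -> y <= 1 -> x <= p <= y ->
    dist (f x) (f p) `^ t <= M * dist (f x) (f y).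
Proof.
move=> t0 hK [M M0 hM]; exists M => // x p y x0 y1 /andP[xp py].
have x01 : 0 <= x <= 1 by lra.
have y01 : 0 <= y <= 1 by lra.
have xy : x <= y by lra.
apply: le_trans (hM _ _ (L_f x01) (L_f y01)).
have dd : dist (f x) (f p) <= diam (subarc L (f x) (f y)).
  apply: (@diam_ge _ (K + K)).
  - move=> _ _ /(subarc_f _ x0 xy y1)[s hs ->] /(subarc_f _ x0 xy y1)[s' hs' ->].
    rewrite /dist (le_trans (le_normcD _ _)) // normcN.
    by rewrite lerD // hK //; lra.
  - by apply/subarc_f => //; exists x; rewrite ?lexx.
  - by apply/subarc_f => //; exists p; rewrite ?xp.
by apply: ge0_ler_powR => //; rewrite ?nnegrE ?dist_ge0 // (le_trans _ dd) // dist_ge0.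
Qed.

End Arcs.

(** * The basic figure *)

Section Figure.
Variable R : realType.
Local Notation C := (plane R).
Variables b r : R.
Hypothesis b_bounds : 8 / 27 <= b <= 4 / 9.
Hypothesis r_bounds : 0 < r <= 1 / 20.

(* Since [apex ^ 2 / `|apex| ^ 2 = (4 + 3i) / 5], the direction [(-4 + 3i) / 5] of
   the second segment makes [S 1 apex - z 1] a positive multiple of
   [S 0 apex - z 1]. *)
Definition vertex (j : nat) : C :=
  nth 1 [:: 0; (4 / 9)%:C; (4 / 9 - 4 / 5 * r) +i* (3 / 5 * r); apex R;
            (1 - b)%:C; 1] j.

Local Notation S := (piece vertex).
Local Notation T := (@model_triangle R).

Lemma Re_piece (z : nat -> C) j w : complex.Re (piece z j w) =
  complex.Re (z j) + (complex.Re (z j.+1) - complex.Re (z j)) * complex.Re w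
                   - (complex.Im (z j.+1) - complex.Im (z j)) * complex.Im w.
Proof. by rewrite /piece; case: (z j) (z j.+1) w => ? ? [? ?] [? ?] /=; ring. Qed.

Lemma Im_piece (z : nat -> C) j w : complex.Im (piece z j w) =
  complex.Im (z j) + (complex.Re (z j.+1) - complex.Re (z j)) * complex.Im w
                   + (complex.Im (z j.+1) - complex.Im (z j)) * complex.Re w.
Proof. by rewrite /piece; case: (z j) (z j.+1) w => ? ? [? ?] [? ?] /=; ring. Qed.

Let coord := (Re_piece, Im_piece).

Lemma vertex_ratio j : (j < 5)%N -> normc (vertex j.+1 - vertex j) <= 1 / 2.
Proof.
have /andP[b0 b1] := b_bounds; have /andP[r0 r1] := r_bounds.
case: j => [|[|[|[|[|j]]]]] // _; rewrite (le_trans (normc_leD _)) //=.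
- rewrite !subr0 normr0 ger0_norm; lra.
- rewrite ler0_norm ?ger0_norm; lra.
- rewrite !ger0_norm; lra.
- rewrite ger0_norm ?ler0_norm; lra.
- rewrite subr0 normr0 ger0_norm; lra.
Qed.

Lemma vertex_neq j : (j < 5)%N -> vertex j.+1 != vertex j.
Proof.
have /andP[b0 b1] := b_bounds; have /andP[r0 r1] := r_bounds.
by case: j => [|[|[|[|[|j]]]]] // _; apply/eqP => /(congr1 (@complex.Re R)) /=; lra.
Qed.

Lemma piece_triangle j w : (j < 5)%N -> T w -> T (S j w).
Proof.
have /andP[b0 b1] := b_bounds; have /andP[r0 r1] := r_bounds.
move=> + /model_triangleE; case: w => x y /= + [h1 h2 h3].
case: j => [|[|[|[|[|j]]]]] // _; apply/model_triangleE; rewrite !coord /=;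
  split; nra.
Qed.

(** The constant involves [r] because the first and third pieces are kept apart only by the second
    segment, of length [r]. *)
Lemma apart_pieces i j w w' : (i.+1 < j)%N -> (j < 5)%N -> T w -> T w' ->
  r / 4 <= dist (S i w) (S j w').
Proof.
have /andP[b0 b1] := b_bounds; have /andP[r0 r1] := r_bounds.
move=> ij j5 /model_triangleE[h1 h2 h3] /model_triangleE[h1' h2' h3'].
have := dist_geRe (S i w) (S j w'); have := dist_geIm (S i w) (S j w').
rewrite !ler_norml => /andP[+ _] /andP[+ _]; rewrite !coord.
move: (dist _ _) => d.
case: w w' h1 h2 h3 h1' h2' h3' => x y [x' y'] /= h1 h2 h3 h1' h2' h3'.
by case: i j ij j5 => [|[|[|[|[|i]]]]] [|[|[|[|[|j]]]]] //= _ _; nra.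
Qed.

Let vertex_len : [/\ normc (vertex 2 - vertex 1) <= 7 / 5 * r,
  normc (vertex 3 - vertex 2) <= 1 / 4, normc (vertex 4 - vertex 3) <= 2 / 5 &
  normc (vertex 5 - vertex 4) <= b].
Proof.
have /andP[b0 b1] := b_bounds; have /andP[r0 r1] := r_bounds.
split; rewrite (le_trans (normc_leD _)) //=.
- rewrite ler0_norm ?ger0_norm; lra.
- rewrite !ger0_norm; lra.
- rewrite ger0_norm ?ler0_norm; lra.
- rewrite subr0 normr0 ger0_norm; lra.
Qed.

Lemma piece_1 i : S i 1 = vertex i.+1.
Proof. by rewrite /piece mulr1 addrC subrK. Qed.

Lemma piece_0 i : S i 0 = vertex i.
Proof. by rewrite /piece mulr0 addr0. Qed.

(** At the corners [z 2], [z 3], [z 4] the two triangles lie in sectors separated by a positive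
    angle, so distances between them grow linearly with the distances to the vertex. The corner
    [z 1] is the exception. *)
Lemma near_pieces i w w' : (0 < i)%N -> (i.+1 < 5)%N -> T w -> T w' ->
  dist (S i w) (vertex i.+1) + dist (S i.+1 w') (vertex i.+1) <=
  20 * dist (S i w) (S i.+1 w').
Proof.
have /andP[b0 b1] := b_bounds; have /andP[r0 r1] := r_bounds.
move=> i0 i5 /model_triangleE[h1 h2 h3] /model_triangleE[h1' h2' h3'].
rewrite -[X in dist (S i w) X + _]piece_1 -[X in _ + dist _ X]piece_0.
rewrite ![dist (S _ _) (S _ _) in leLHS]dist_piece.
have := dist_geRe (S i w) (S i.+1 w'); have := dist_geIm (S i w) (S i.+1 w').
rewrite !ler_norml => /andP[+ +] /andP[+ +]; rewrite !coord.
move: (dist (S i w) _) => d.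
have := dist_ge0 w 1; have : dist w 1 <= 4 / 3 * (1 - complex.Re w).
  rewrite (le_trans (normc_leD _)) //; case: w h1 h2 h3 => x y /= ? ? ?.
  by rewrite subr0 ler0_norm ?ger0_norm //; lra.
have := dist_ge0 w' 0; have : dist w' 0 <= 4 / 3 * complex.Re w'.
  rewrite (le_trans (normc_leD _)) //; case: w' h1' h2' h3' => x y /= ? ? ?.
  by rewrite !subr0 !ger0_norm //; lra.
move: (dist w 1) (dist w' 0) => e' e.
have [l1 l2 l3 l4] := vertex_len.
have := normc_ge0 (vertex i.+1 - vertex i).
have := normc_ge0 (vertex i.+2 - vertex i.+1).
move: w w' h1 h2 h3 h1' h2' h3' => [x y] [x' y'].
move: i i0 i5 => [|[|[|[|i]]]] //= _ _; move: l1 l2 l3 l4 => /=.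
- move=> + + _ _; move: (Num.sqrt _) (Num.sqrt _) => N2 N1 l1 l2.
  move=> h1 h2 h3 h1' h2' h3' N20 N10 e1 e0 e1' e0' d1 d2 d3 d4.
  have k1 := ler_pM N10 e0' l1 e1'.
  have k2 := ler_pM N20 e0 l2 e1.
  nra.
- move=> _ + + _; move: (Num.sqrt _) (Num.sqrt _) => N2 N1 l1 l2.
  move=> h1 h2 h3 h1' h2' h3' N20 N10 e1 e0 e1' e0' d1 d2 d3 d4.
  have k1 := ler_pM N10 e0' l1 e1'.
  have k2 := ler_pM N20 e0 l2 e1.
  nra.
- move=> _ _; move: (Num.sqrt _) (Num.sqrt _) => N2 N1 l1 l2.
  move=> h1 h2 h3 h1' h2' h3' N20 N10 e1 e0 e1' e0' d1 d2 d3 d4.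
  have k1 := ler_pM N10 e0' l1 e1'.
  have k2 := ler_pM N20 e0 l2 e1.
  nra.
Qed.

(** The right side is a multiple of the distance from [v] to the side joining 1 to the apex. The
    left side compares the projection of [v] on that side, in units where the apex is at 1, with the
    apex. So pieces other than the last meet this side at most at the apex, and depart from it at a
    positive angle. *)
Lemma right_cone j w : (j < 4)%N -> T w -> 
  let v := S j w in
  `|9 / 5 * (1 - complex.Re v) + 3 / 5 * complex.Im v - 1| <=
    100 * (1 - complex.Re v - 3 * complex.Im v).
Proof.
have /andP[b0 b1] := b_bounds; have /andP[r0 r1] := r_bounds.
move=> + /model_triangleE; case: w => x y /= + [h1 h2 h3].
rewrite !coord ler_norml.
by case: j => [|[|[|[|j]]]] // _ /=; apply/andP; split; nra.
Qed.

(** The mirror image for the side joining 0 to the apex, which only the first piece meets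
    elsewhere. *)
Lemma left_cone j w : (0 < j)%N -> (j < 5)%N -> T w -> 
  let v := S j w in
  `|9 / 5 * complex.Re v + 3 / 5 * complex.Im v - 1| <=
    100 * (complex.Re v - 3 * complex.Im v).
Proof.
have /andP[b0 b1] := b_bounds; have /andP[r0 r1] := r_bounds.
move=> + + /model_triangleE; case: w => x y /= + + [h1 h2 h3].
rewrite !coord ler_norml.
by case: j => [|[|[|[|[|j]]]]] // _ _ /=; apply/andP; split; nra.
Qed.

Lemma piece_Re_lt1 j w : (j < 4)%N -> T w -> complex.Re (S j w) <= 3 / 4.
Proof.
have /andP[b0 b1] := b_bounds; have /andP[r0 r1] := r_bounds.
move=> + /model_triangleE; case: w => x y /= + [h1 h2 h3]; rewrite !coord.
by case: j => [|[|[|[|j]]]] // _ /=; nra.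
Qed.

Lemma piece_Re_gt0 j w : (0 < j)%N -> (j < 5)%N -> T w -> 1 / 4 <= complex.Re (S j w).
Proof.
have /andP[b0 b1] := b_bounds; have /andP[r0 r1] := r_bounds.
move=> + + /model_triangleE; case: w => x y /= + + [h1 h2 h3]; rewrite !coord.
by case: j => [|[|[|[|[|j]]]]] // _ _ /=; nra.
Qed.

End Figure.

Section Arguments.
Variable R : realType.
Local Notation C := (plane R).

Lemma carg_ge0 (w : C) : 0 <= carg w.
Proof.
have [->|/cargP[/andP[]]//] := eqVneq w 0.
by rewrite /carg /= lexx mul0r acos0 divr_ge0 // pi_ge0.
Qed.

Lemma carg_real (a : R) : 0 < a -> carg a%:C = 0.
Proof.
by move=> a0; rewrite /carg normc_real /= lexx gtr0_norm // divff ?gt_eqF // acos1.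
Qed.

Lemma carg_quotient_gt0 (u v : C) :
  complex.Im u * complex.Re v != complex.Re u * complex.Im v -> 0 < carg (u / v).
Proof.
move=> uv; rewrite lt_neqAle carg_ge0 andbT eq_sym; apply/negP => /eqP h.
have v0 : v != 0 by apply: contraNneq uv => ->; rewrite /= !mulr0.
have u0 : u != 0 by apply: contraNneq uv => ->; rewrite /= !mul0r.
have /cargP[_] : u / v != 0 by rewrite mulf_neq0 // invr_eq0.
rewrite h cos0 sin0 => e.
have ue : u = (normc (u / v))%:C * v by rewrite -[LHS](divfK v0) {1}e mulr1.
move/negP: uv; apply; apply/eqP; rewrite ue; case: v {v0 e ue h} => c d /=; ring.
Qed.

End Arguments.

(** * The five-segment polygon as a basic figure with [theta_min = 0] *)

Section BasicFigure.
Variable R : realType.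
Local Notation C := (plane R).
Variables b r : R.
Hypothesis b_bounds : 8 / 27 <= b <= 4 / 9.
Hypothesis r_bounds : 0 < r <= 1 / 20.
Local Notation z := (vertex b r).
Local Notation S := (piece z).
Local Notation T := (@model_triangle R).
Let coord := (Re_piece, Im_piece).

Let similE j w : simil 5 z j.+1 w = S j w.
Proof. exact: simil_piece. Qed.

Let Pi0E : Pi0 5 z 3 = interior T. Proof. by []. Qed.
Let Pi1E : Pi1 5 z 3 = T. Proof. by rewrite /Pi1 Pi0E closure_model_interior. Qed.

Let interior_triangle w : interior T w -> T w.
Proof. exact: interior_subset. Qed.

Lemma apex_in : T (apex R).
Proof. by apply/model_triangleE => /=; split; lra. Qed.

Lemma interior_pieces_disjoint i j w w' : (i < j)%N -> (j < 5)%N ->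
  interior T w -> interior T w' -> S i w <> S j w'.
Proof.
have /andP[b0 b1] := b_bounds; have /andP[r0 r1] := r_bounds.
move=> ij j5 iw iw' e.
have Tw := interior_triangle iw; have Tw' := interior_triangle iw'.
have [ij1|ji1] := ltnP i.+1 j.
  have := apart_pieces b_bounds r_bounds ij1 j5 Tw Tw'.
  by rewrite e distxx; lra.
have {ij ji1} ej : j = i.+1 by apply/eqP; rewrite eqn_leq ji1.
rewrite {}ej in j5 e.
have [i0|i0] := posnP i; last first.
  have := near_pieces b_bounds r_bounds i0 j5 Tw Tw'.
  rewrite e distxx mulr0 -e -piece_1 dist_piece => h.
  have : normc (z i.+1 - z i) * dist w 1 = 0.
    apply/eqP; rewrite eq_le mulr_ge0 ?normc_ge0 ?dist_ge0 // andbT.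
    by have := dist_ge0 (S i w) (S i 1); have := dist_ge0 (S i w) (z i.+1); lra.
  move/eqP; rewrite mulf_eq0 => /orP[/eqP/eq0_normc/eqP|/eqP/dist_eq0 w1].
    by rewrite subr_eq0; apply/negP/vertex_neq => //; exact: ltnW.
  by move: iw => /model_interiorE[]; rewrite w1 /=; lra.
(* The first two pieces are separated by the line [Re + 3 Im = 4/9], which carries their coinciding
   sides. *)
move: e; rewrite {}i0 => e; have := congr1 (@complex.Re R) e.
move/(congr1 (@complex.Im R)): e; rewrite !coord /=.
move: iw iw' => /model_interiorE[h1 h2 h3] /model_interiorE[h1' h2' h3'].
move: (complex.Re w) (complex.Im w) (complex.Re w') (complex.Im w') h1 h2 h3 h1' h2' h3'.
move=> x y x' y'; nra.
Qed.

Lemma figure_basic : basic_figure 5 z 3.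
Proof.
have /andP[b0 b1] := b_bounds; have /andP[r0 r1] := r_bounds.
split=> //.
- move=> p p'; case: p => [|[|[|[|[|[|p]]]]]] //; case: p' => [|[|[|[|[|[|p']]]]]] // _ _;
    first [move=> _; reflexivity
          |by move=> /(congr1 (@complex.Re R)) /= e; exfalso; lra].
- exists (4 / 9); first by rewrite /= in_itv /=; apply/andP; split; lra.
  by rewrite /= add0r subr0 mulr1.
- exists (1 - b); first by rewrite /= in_itv /=; apply/andP; split; lra.
  by rewrite /= add0r subr0 mulr1.
- exists (1 - 9 / 5 * b); first by rewrite /= in_itv /=; apply/andP; split; lra.
  by apply/eqP; rewrite eq_complex /=; apply/andP; split; apply/eqP; lra.
- case=> [|[|[|[|[|[|p]]]]]] // _.
  + by left; right; exists 0; rewrite /= ?in_itv /= ?lexx ?ler01 // mul0r addr0.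
  + left; right; exists (4 / 9); first by rewrite /= in_itv /=; apply/andP; split; lra.
    by rewrite /= add0r subr0 mulr1.
  + by right; apply/model_interiorE => /=; split; lra.
  + by left; left.
  + left; right; exists (1 - b); first by rewrite /= in_itv /=; apply/andP; split; lra.
    by rewrite /= add0r subr0 mulr1.
  + left; right; exists 1; rewrite /= ?in_itv /= ?lexx ?ler01 //.
    by rewrite add0r subr0 mulr1.
- move=> [|j] // /andP[_ j5]; exists (1 / 2); first by lra.
  by move=> x y; rewrite !similE dist_piece ler_wpM2r ?dist_ge0 // vertex_ratio.
- move=> [|i] [|j] // /andP[_ i5] /andP[_ j5] [_ [[w iw <-] [w' iw']]].
  rewrite !similE => e; congr _.+1; apply/eqP.
  have [ij|ij|//] := ltngtP i j; exfalso.
    exact: (interior_pieces_disjoint ij j5 iw iw').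
  exact: (interior_pieces_disjoint ij i5 iw' iw).
- move=> [|j] // /andP[_ j5]; rewrite Pi1E similE.
  exact: piece_triangle apex_in.
(* Of the five indices only 2 lies outside the list 1, 5, 3, 4. *)
- move=> [|[|[|[|[|[|j]]]]]] // _ _.
  rewrite Pi1E; apply/seteqP; split=> // v [[w /model_triangleE[h1 h2 h3] <-]].
  rewrite similE; move: w h1 h2 h3 => [x y] /= h1 h2 h3.
  case=> -[t _] e; have := congr1 (@complex.Im R) e;
    move/(congr1 (@complex.Re R)): e; rewrite !coord /=; nra.
- by rewrite (_ : z 0 = 0) // (_ : z 5 = 1) // !subr0 divr1 /=; lra.
Qed.

Lemma figure_theta_min : theta_min 5 z 3 = 0.
Proof.
have /andP[b0 b1] := b_bounds; have /andP[r0 r1] := r_bounds.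
have th1 : theta 5 z 3 1 = 0.
  rewrite /theta !similE.
  have -> : (S 0 (z 3) - z 1) / (S 1 (z 3) - z 1) = ((4 / 9) / r)%:C.
    have d0 : S 1 (z 3) - z 1 != 0.
      by apply/eqP => /(congr1 (@complex.Im R)); rewrite /piece /=; nra.
    apply: (mulIf d0); rewrite divfK // /piece /=; apply/eqP; rewrite eq_complex /=.
    by apply/andP; split; apply/eqP; field; rewrite gt_eqF.
  by apply: carg_real; rewrite divr_gt0 //; lra.
apply/eqP; rewrite eq_le; apply/andP; split.
  by rewrite /theta_min big_ltn // ge_min th1 lexx.
rewrite /theta_min; elim/big_ind : _ => [|x y x0 y0|p _]; rewrite ?carg_ge0 //.
by rewrite le_min x0.
Qed.

Lemma figure_characteristic : 0 < characteristic_angle 5 z 3.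
Proof.
have /andP[b0 b1] := b_bounds; have /andP[r0 r1] := r_bounds.
rewrite /characteristic_angle figure_theta_min add0r /eta0 lt_min.
(* It remains to see that the two pieces at the apex do not lie along the sides of the large
   triangle there. *)
apply/andP; split; apply: carg_quotient_gt0; rewrite similE /piece /=;
  apply/negP => /eqP; nra.
Qed.

End BasicFigure.

(* The sizes of [S_1 S_5^n] and [S_2 S_1^m] of the whole arc, up to a common
   factor: the touching points of the two pieces sit at these distances from
   their common vertex. *)
Definition left_size (R : realType) (b : R) n : R := 4 / 9 * b ^+ n.
Definition right_size (R : realType) (r : R) m : R := r * (4 / 9) ^+ m.

(** * Bounded turning of the curve and its cusp at [z 1] *)

Section FigureCurve.
Variable R : realType.
Local Notation C := (plane R).
Variables b r : R.
Hypothesis b_bounds : 8 / 27 <= b <= 4 / 9.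
Hypothesis r_bounds : 0 < r <= 1 / 20.
Local Notation z := (vertex b r).
Local Notation S := (piece z).
Local Notation T := (@model_triangle R).
Local Notation a := (4 / 9 : R).

Variable f : R -> C.
Hypothesis f_0 : f 0 = 0.
Hypothesis f_1 : f 1 = 1.
Hypothesis f_piece : forall j s, (j < 5)%N -> 0 <= s <= 1 ->
  f ((j%:R + s) / 5%:R) = S j (f s).
Hypothesis f_T : forall s, 0 <= s <= 1 -> T (f s).

Let half01 : (0 <= (1 / 2 : R)) && ((1 / 2 : R) < 1).
Proof. by apply/andP; split; lra. Qed.

Let five_pieces (t : R) : 0 <= t <= 1 -> exists j s,
  [/\ (j < 5)%N, 0 <= s <= 1 & t = (j%:R + s) / 5%:R].
Proof.
move=> t01; have [d s] := @digitP R 5 isT t t01.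
by exists (digit 5 t), (shift 5 t); split=> //; exact: digit_shift.
Qed.

Lemma triangle_dist0 w : T w -> dist w 0 <= 3.
Proof.
move=> /model_triangleE[h1 h2 h3]; rewrite /dist (le_trans (normc_leD _)) //.
by case: w h1 h2 h3 => x y /= ? ? ?; rewrite !subr0 !ger0_norm; lra.
Qed.

Lemma triangle_dist1 w : T w -> dist w 1 <= 3.
Proof.
move=> /model_triangleE[h1 h2 h3]; rewrite /dist (le_trans (normc_leD _)) //.
by case: w h1 h2 h3 => x y /= ? ? ?; rewrite subr0 ler0_norm ?ger0_norm; lra.
Qed.

Lemma piece_first w : S 0 w = a%:C * w.
Proof. by rewrite /piece /= add0r subr0. Qed.

Lemma piece_last w : 1 - S 4 w = b%:C * (1 - w).
Proof.
by rewrite /piece /=; case: w => x y; apply/eqP; rewrite eq_complex /=;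
  apply/andP; split; apply/eqP; ring.
Qed.

Let b0 : 0 < b. Proof. by case/andP: b_bounds => b0 b1; lra. Qed.

(** [n] counts the leading last digits of [s]: the parameter leaves the last piece after [n] steps,
    and all later points stay in the [n]-fold image, of size [b ^ n]. *)
Lemma tail_last s : 0 <= s < 1 -> exists n j w,
  [/\ (j < 4)%N, T w, 1 - f s = (b ^+ n)%:C * (1 - S j w) &
      forall p, s <= p <= 1 -> dist (f p) 1 <= 3 * b ^+ n].
Proof.
move=> /andP[s0 s1].
have [|n] := @exp_gt_exists R 5 (1 - s) isT; first by lra.
elim: n s s0 s1 => [|n IH] s s0 s1; first by rewrite expr0; lra.
have s01 : 0 <= s <= 1 by rewrite s0 ltW.
have [j [s' [j5 s01' es]]] := five_pieces s01.
have [j4|j4] := ltnP j 4.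
  move=> _; exists 0%N, j, (f s'); split=> //; first exact: f_T.
    by rewrite expr0 mul1r es f_piece.
  move=> p /andP[sp p1]; rewrite expr0 mulr1; apply/triangle_dist1/f_T.
  by rewrite p1 (le_trans s0).
have {j4 j5} ej : j = 4%N by apply/eqP; rewrite eqn_leq -ltnS j5.
move: es; rewrite {}ej => es hn; have [s0' s1'] := andP s01'.
have [||n' [j' [w' [j4 Tw' e hp]]]] := IH s' s0'.
- by rewrite es in s1; lra.
- apply: lt_le_trans hn _; rewrite exprS es.
  by have : 0 <= 5%:R ^+ n :> R; [exact: exprn_ge0|nra].
exists n'.+1, j', w'; split=> //.
  by rewrite es f_piece // piece_last e mulrA -rmorphM -exprS.
move=> p /andP[sp p1].
have ep : p = (4%:R + (5 * p - 4)) / 5%:R by field.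
have p01 : 0 <= 5 * p - 4 <= 1 by rewrite es in sp; lra.
have e1 : (1 : C) = S 4 1 by rewrite piece_1.
rewrite ep f_piece // [X in dist _ X]e1 dist_piece.
have -> : normc (z 5 - z 4) = b.
  by rewrite /= subrr expr0n addr0 sqrtr_sqr subKr gtr0_norm.
rewrite exprS mulrCA ler_wpM2l ?(ltW b0) // hp //.
by rewrite es in sp; lra.
Qed.

Lemma tail_first s : 0 < s <= 1 -> exists n j w,
  [/\ (0 < j < 5)%N, T w, f s = (a ^+ n)%:C * S j w &
      forall p, 0 <= p <= s -> dist (f p) 0 <= 3 * a ^+ n].
Proof.
move=> /andP[s0 s1].
have [|n] := @exp_gt_exists R 5 s isT; first by lra.
elim: n s s0 s1 => [|n IH] s s0 s1; first by rewrite expr0; lra.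
have s01 : 0 <= s <= 1 by rewrite s1 ltW.
have [j [s' [j5 s01' es]]] := five_pieces s01.
have [j0|j0] := posnP j; last first.
  move=> _; exists 0%N, j, (f s'); split=> //; first by rewrite j0.
  - exact: f_T.
  - by rewrite expr0 mul1r es f_piece.
  move=> p /andP[p0 ps]; rewrite expr0 mulr1; apply/triangle_dist0/f_T.
  by rewrite p0 (le_trans ps).
move: es; rewrite {j5}j0 => es hn; have [s0' s1'] := andP s01'.
have [|||n' [j' [w' [j4 Tw' e hp]]]] := IH s'.
- by rewrite es in s0; lra.
- by [].
- apply: lt_le_trans hn _; rewrite exprS es.
  by have : 0 <= 5%:R ^+ n :> R; [exact: exprn_ge0|nra].
exists n'.+1, j', w'; split=> //.
  by rewrite es f_piece // piece_first e mulrA -rmorphM -exprS.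
move=> p /andP[p0 ps].
have ep : p = (0%:R + 5 * p) / 5%:R by field.
have p01 : 0 <= 5 * p <= 1 by rewrite es in ps; lra.
have e0 : (0 : C) = S 0 0 by rewrite piece_0.
rewrite ep f_piece // [X in dist _ X]e0 dist_piece.
have -> : normc (z 1 - z 0) = a.
  by rewrite /= !subr0 expr0n addr0 sqrtr_sqr gtr0_norm // divr_gt0.
rewrite exprS mulrCA ler_wpM2l //.
by apply: hp; rewrite es in ps; lra.
Qed.

Lemma tail_last_lt s : 0 <= s < 1 -> 0 < dist (f s) 1.
Proof.
move=> /tail_last[n [j [w [j4 Tw e _]]]].
rewrite dist_sym /dist e normcM normc_real mulr_gt0 ?normr_gt0 ?expf_neq0 ?gt_eqF //.
apply: lt_le_trans (normc_geRe _); rewrite gtr0_norm raddfB /=.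
  by have := piece_Re_lt1 b_bounds r_bounds j4 Tw; lra.
by have := piece_Re_lt1 b_bounds r_bounds j4 Tw; lra.
Qed.

(** In the notation of [tail_last], later points are within [3 b^n] of 1, while [f s] is at distance
    at least [b^n / 4] from it. *)
Lemma tail_last_le s p : 0 <= s -> s <= p <= 1 -> dist (f p) 1 <= 12 * dist (f s) 1.
Proof.
move=> s0 /andP[sp p1]; have [s1|s1] := ltP s 1; last first.
  have -> : p = 1 by lra.
  by rewrite f_1 distxx mulr_ge0 ?dist_ge0.
have [|n [j [w [j4 Tw e hp]]]] := @tail_last s; first by rewrite s0.
have := hp p; rewrite sp p1 => /(_ isT) h.
have bn : 0 <= b ^+ n by rewrite exprn_ge0 // ltW.
rewrite [dist (f s) 1]dist_sym /dist e normcM normc_real (ger0_norm bn).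
have : 1 / 4 <= normc (1 - S j w).
  apply: le_trans (normc_geRe _); rewrite gtr0_norm raddfB /=;
    by have := piece_Re_lt1 b_bounds r_bounds j4 Tw; lra.
by move: h; rewrite /dist; nra.
Qed.

Lemma tail_first_lt s : 0 < s <= 1 -> 0 < dist (f s) 0.
Proof.
move=> /tail_first[n [j [w [/andP[j0 j5] Tw e _]]]].
rewrite /dist subr0 e normcM normc_real mulr_gt0 //.
  by rewrite normr_gt0 expf_neq0 // gt_eqF; lra.
apply: lt_le_trans (normc_geRe _); rewrite gtr0_norm;
  by have := piece_Re_gt0 b_bounds r_bounds j0 j5 Tw; lra.
Qed.

Lemma tail_first_le s p : s <= 1 -> 0 <= p <= s -> dist (f p) 0 <= 12 * dist (f s) 0.
Proof.
move=> s1 /andP[p0 ps]; have [s0|s0] := ltP 0 s; last first.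
  have -> : p = 0 by lra.
  by rewrite f_0 distxx mulr_ge0 ?dist_ge0.
have [|n [j [w [/andP[j0 j5] Tw e hp]]]] := @tail_first s; first by rewrite s0.
have := hp p; rewrite p0 ps => /(_ isT) h.
have an : 0 <= a ^+ n by rewrite exprn_ge0; lra.
rewrite /dist !subr0 in h *; rewrite e normcM normc_real (ger0_norm an).
have : 1 / 4 <= normc (S j w).
  apply: le_trans (normc_geRe _); rewrite gtr0_norm;
    by have := piece_Re_gt0 b_bounds r_bounds j0 j5 Tw; lra.
by nra.
Qed.

Lemma adjacent_between i s u p : (i.+1 < 5)%N -> 0 <= s <= 1 -> 0 <= u <= 1 ->
  (i%:R + s) / 5%:R <= p <= (i.+1%:R + u) / 5%:R ->
  dist (f p) (z i.+1) <=
    12 * (dist (S i (f s)) (z i.+1) + dist (S i.+1 (f u)) (z i.+1)).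
Proof.
move=> i5 /andP[s0 s1] /andP[u0 u1] /andP[sp pu].
have [hp|hp] := leP p (i.+1%:R / 5%:R).
  have ep : p = (i%:R + (5 * p - i%:R)) / 5%:R by field.
  have sp' : s <= 5 * p - i%:R <= 1 by rewrite -natr1 in hp; lra.
  rewrite ep f_piece; [|exact: ltnW|by lra].
  rewrite -[X in dist (S i _) X](piece_1 b r) dist_piece.
  rewrite -[X in dist (S i (f s)) X](piece_1 b r) dist_piece.
  have := tail_last_le s0 sp'; have := normc_ge0 (z i.+1 - z i).
  have := dist_ge0 (S i.+1 (f u)) (z i.+1); nra.
have ep : p = (i.+1%:R + (5 * p - i.+1%:R)) / 5%:R by field.
have up' : 0 <= 5 * p - i.+1%:R <= u by lra.
rewrite ep f_piece //; last by lra.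
rewrite -[X in dist (S i.+1 _) X](piece_0 b r) dist_piece.
rewrite -[X in dist (S i.+1 (f u)) X](piece_0 b r) dist_piece.
have := tail_first_le u1 up'; have := normc_ge0 (z i.+2 - z i.+1).
have := dist_ge0 (S i (f s)) (z i.+1); nra.
Qed.

(* Seen from [z 1], in units of the common direction of the two touching sides,
   the two points are [u X] and [v Y] with [Im X >= 0 >= Im Y], while [Re X - 1]
   and [Re Y - 1] are controlled by the imaginary parts. *)
Lemma cusp_gap n m j k x y w w' : (j < 4)%N -> (0 < k < 5)%N -> T w -> T w' ->
  1 - x = (b ^+ n)%:C * (1 - S j w) -> y = (a ^+ m)%:C * S k w' ->
  `|left_size b n - right_size r m| <= 1000 * dist (S 0 x) (S 1 y).
Proof.
move=> j4 /andP[k0 k5] Tw Tw' ex ey.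
have := right_cone b_bounds r_bounds j4 Tw; have := left_cone b_bounds r_bounds k0 k5 Tw'.
move: (S j w) (S k w') ex ey => X Y ex ey /=.
have := dist_geRe (S 0 x) (S 1 y); have := dist_geIm (S 0 x) (S 1 y).
rewrite !Re_piece !Im_piece /=.
have -> : x = 1 - (b ^+ n)%:C * (1 - X) by rewrite -ex opprB addrC subrK.
have u0 : 0 < left_size b n.
  by rewrite /left_size mulr_gt0 ?exprn_gt0 //; lra.
have v0 : 0 < right_size r m.
  by case/andP: r_bounds => r0 _; rewrite /right_size mulr_gt0 ?exprn_gt0 //; lra.
move: u0 v0; rewrite ey /left_size /right_size.
move: (b ^+ n) (a ^+ m) (dist _ _) => B A d.
case: X Y {ex ey} => x1 x2 [y1 y2] /= u0 v0.
rewrite !ler_norml => /andP[d1 d2] /andP[d3 d4] /andP[l1 l2] /andP[r1 r2].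
set u := 4 / 9 * B in u0 *; set v := r * A in v0 *.
have m1 : u * (9 / 5 * (1 - x1) + 3 / 5 * x2 - 1) <= u * (100 * (1 - x1 - 3 * x2)).
  by rewrite ler_pM2l.
have m2 : u * - (100 * (1 - x1 - 3 * x2)) <= u * (9 / 5 * (1 - x1) + 3 / 5 * x2 - 1).
  by rewrite ler_pM2l.
have m3 : v * (9 / 5 * y1 + 3 / 5 * y2 - 1) <= v * (100 * (y1 - 3 * y2)).
  by rewrite ler_pM2l.
have m4 : v * - (100 * (y1 - 3 * y2)) <= v * (9 / 5 * y1 + 3 / 5 * y2 - 1).
  by rewrite ler_pM2l.
rewrite /u /v in m1 m2 m3 m4 *.
apply/andP; split; lra.
Qed.

Let r0 : 0 < r. Proof. by case/andP: r_bounds. Qed.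

Let last_eq i s : (i < 5)%N -> 0 <= s <= 1 ->
  dist (S i (f s)) (z i.+1) <= 0 -> s = 1.
Proof.
move=> i5 /andP[s0 s1]; rewrite -[X in dist _ X](piece_1 b r) dist_piece => h.
apply/eqP; rewrite eq_le s1 leNgt; apply/negP => lt.
have := @tail_last_lt s.
rewrite s0 lt => /(_ isT) d0.
have : 0 < normc (z i.+1 - z i); last by nra.
rewrite lt_neqAle normc_ge0 andbT eq_sym; apply/eqP => /eq0_normc/eqP.
by rewrite subr_eq0; apply/negP/vertex_neq.
Qed.

Let first_eq i s : (i < 5)%N -> 0 <= s <= 1 -> dist (S i (f s)) (z i) <= 0 -> s = 0.
Proof.
move=> i5 /andP[s0 s1]; rewrite -[X in dist _ X](piece_0 b r) dist_piece => h.
apply/eqP; rewrite eq_le s0 andbT leNgt; apply/negP => lt.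
have := @tail_first_lt s.
rewrite s1 lt => /(_ isT) d0.
have : 0 < normc (z i.+1 - z i); last by nra.
rewrite lt_neqAle normc_ge0 andbT eq_sym; apply/eqP => /eq0_normc/eqP.
by rewrite subr_eq0; apply/negP/vertex_neq.
Qed.

Let meet_first s t : 0 <= s <= 1 -> 0 <= t <= 1 ->
  [\/ s = 1, t = 0 | exists n m,
    [/\ dist (f s) 1 <= 3 * b ^+ n, dist (f t) 0 <= 3 * a ^+ m &
    `|left_size b n - right_size r m| <= 1000 * dist (S 0 (f s)) (S 1 (f t))]].
Proof.
move=> /andP[s0 s1] /andP[t0 t1].
have [s1'|s1'] := ltP s 1; last by constructor 1; lra.
have [t0'|t0'] := ltP 0 t; last by constructor 2; lra.
constructor 3.
have [|n [j [w [j4 Tw e hn]]]] := @tail_last s.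
  by rewrite s0.
have [|m [k [w' [k5 Tw' e' hm]]]] := @tail_first t.
  by rewrite t0'.
exists n, m; split.
- by apply: hn; rewrite lexx.
- by apply: hm; rewrite lexx t0.
- exact: (@cusp_gap n m j k _ _ w w').
Qed.

(** Only the first two pieces could meet outside their vertex, on the common ray; [cusp_gap] turns
    such a meeting into an equality of two sizes. *)
Lemma pieces_meet : (forall n m, left_size b n != right_size r m) ->
  forall i j s t, (i < j)%N -> (j < 5)%N -> 0 <= s <= 1 -> 0 <= t <= 1 ->
  S i (f s) = S j (f t) -> [/\ j = i.+1, s = 1 & t = 0].
Proof.
move=> uv i j s t ij j5 s01 t01 e.
have [ij1|ji1] := ltnP i.+1 j.
  have := apart_pieces b_bounds r_bounds ij1 j5 (f_T s01) (f_T t01).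
  by rewrite e distxx; have := r0; lra.
have ej : j = i.+1 by apply/eqP; rewrite eqn_leq ji1.
rewrite {}ej {ij ji1} in j5 e *; have i5 : (i < 5)%N by exact: ltnW.
suff : s = 1 \/ t = 0.
  case=> [s1|t0]; split=> //.
    by apply: (first_eq j5) => //; rewrite -e s1 f_1 piece_1 distxx.
  by apply: (last_eq i5) => //; rewrite e t0 f_0 piece_0 distxx.
have [i0|i0] := posnP i; last first.
  left; apply: (last_eq i5) => //.
  have := near_pieces b_bounds r_bounds i0 j5 (f_T s01) (f_T t01).
  rewrite -e distxx; have := dist_ge0 (S i (f s)) (z i.+1); lra.
have [|->|[n [m [_ _]]]] := meet_first s01 t01; [by left|by right|].
rewrite i0 in e; rewrite e distxx mulr0 normr_le0 subr_eq0.
by have /negP := uv n m.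
Qed.

Lemma figure_injective : (forall n m, left_size b n != right_size r m) ->
  forall s t, 0 <= s <= 1 -> 0 <= t <= 1 -> f s = f t -> s = t.
Proof.
move=> uv; apply: (@curve_injective R 5 z isT f f_piece isT).
  exact: vertex_neq.
exact: pieces_meet.
Qed.

(** Away from the cusp the bound is linear, by [apart_pieces] (the term [24 / r]) or [near_pieces]
    ([480 = 24 * 20]). At the cusp both distances are expressed through the sizes, with
    [180 = 24 * 3 + 24 * 9/2]. *)
Lemma figure_diam i j s u p q : (i < j)%N -> (j < 5)%N ->
  0 <= s <= 1 -> 0 <= u <= 1 ->
  (i%:R + s) / 5%:R <= p <= (j%:R + u) / 5%:R ->
  (i%:R + s) / 5%:R <= q <= (j%:R + u) / 5%:R ->
  let e := dist (S i (f s)) (S j (f u)) in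
  dist (f p) (f q) <= 6 /\
  (dist (f p) (f q) <= (480 + 24 / r) * e \/
   exists n m, dist (f p) (f q) <= 180 * Num.max (left_size b n) (right_size r m) /\
     `|left_size b n - right_size r m| <= 1000 * e).
Proof.
move=> ij j5 s01 u01 hp hq e; have gr := r0; have e0 : 0 <= e by exact: dist_ge0.
have er : 0 <= 24 / r * e by rewrite mulr_ge0 // ltW // divr_gt0.
have lb : 0 <= (i%:R + s) / 5%:R :> R.
  by apply: divr_ge0 => //; apply: addr_ge0 => //; case/andP: s01.
have ub : (j%:R + u) / 5%:R <= 1 :> R.
  have : j%:R <= 4 :> R by rewrite (ler_nat R j 4).
  by case/andP: u01; lra.
have p01 : 0 <= p <= 1.
  by case/andP: hp => h1 h2; rewrite (le_trans lb h1) (le_trans h2 ub).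
have q01 : 0 <= q <= 1.
  by case/andP: hq => h1 h2; rewrite (le_trans lb h1) (le_trans h2 ub).
have d6 : dist (f p) (f q) <= 6.
  have := triangle_dist0 (f_T p01); have := triangle_dist0 (f_T q01).
  by have := dist_triangle 0 (f p) (f q); rewrite (dist_sym 0); lra.
split=> //; have [ij1|ji1] := ltnP i.+1 j.
  left; apply: (le_trans d6).
  have := apart_pieces b_bounds r_bounds ij1 j5 (f_T s01) (f_T u01).
  rewrite -/e ler_pdivrMr // mulrDl => re.
  have : 6 <= 24 / r * e by rewrite mulrAC ler_pdivlMr //; lra.
  by lra.
have ej : j = i.+1 by apply/eqP; rewrite eqn_leq ji1.
rewrite {}ej {ij ji1 ub} in j5 hp hq e e0 er *.
have := dist_triangle (z i.+1) (f p) (f q); rewrite (dist_sym (z _)).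
have := adjacent_between j5 s01 u01 hq; have := adjacent_between j5 s01 u01 hp.
move: (dist (f p) (f q)) (dist (f p) (z i.+1)) (dist (f q) (z i.+1)) d6
  => d dp dq d6 hdp hdq hd.
have {hdp hdq} hd24 : d <=
    24 * (dist (S i (f s)) (z i.+1) + dist (S i.+1 (f u)) (z i.+1)).
  by lra.
have linear : d <= 480 * e -> d <= (480 + 24 / r) * e.
  by rewrite mulrDl; lra.
have [i0|i0] := posnP i; last first.
  left; apply: linear.
  have := near_pieces b_bounds r_bounds i0 j5 (f_T s01) (f_T u01).
  by rewrite -/e; lra.
rewrite {}i0 {hp hq lb} in j5 hd24 e e0 er linear *.
have [s1|u0|[n [m [hn hm hgap]]]] := meet_first s01 u01.
- left; apply: linear; move: hd24; rewrite /e s1 f_1 piece_1 distxx add0r.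
  by have := dist_ge0 (z 1) (S 1 (f u)); rewrite (dist_sym (z 1)); lra.
- left; apply: linear; move: hd24; rewrite /e u0 f_0 piece_0 distxx addr0.
  by have := dist_ge0 (S 0 (f s)) (z 1); lra.
right; exists n, m; split=> //.
have h1 : dist (S 0 (f s)) (z 1) <= 3 * left_size b n.
  rewrite -[X in dist _ X](piece_1 b r) dist_piece.
  have -> : normc (z 1 - z 0) = a.
    by rewrite /= !subr0 expr0n addr0 sqrtr_sqr gtr0_norm // divr_gt0.
  by rewrite /left_size; lra.
have h2 : dist (S 1 (f u)) (z 1) <= 9 / 2 * right_size r m.
  rewrite -[X in dist _ X](piece_0 b r) dist_piece.
  have len : normc (z 2 - z 1) <= 3 / 2 * r.
    by rewrite (le_trans (normc_leD _)) //= ler0_norm ?ger0_norm; lra.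
  have := ler_pM (normc_ge0 _) (dist_ge0 _ _) len hm.
  by rewrite /right_size; lra.
set w := Num.max _ _.
have wl : left_size b n <= w by rewrite le_max lexx.
have wr : right_size r m <= w by rewrite le_max lexx orbT.
have w0 : 0 < w.
  by apply: lt_le_trans wl; rewrite /left_size mulr_gt0 ?exprn_gt0 // divr_gt0.
by lra.
Qed.

Lemma figure_curve_quasi_arc (t M : R) : 1 <= t -> 0 < M ->
  (forall n m, Num.max (left_size b n) (right_size r m) `^ t <=
               M * `|left_size b n - right_size r m|) ->
  exists2 M' : R, 0 < M' & forall x y p q, 0 <= x -> y <= 1 ->
    x <= p <= y -> x <= q <= y -> dist (f p) (f q) `^ t <= M' * dist (f x) (f y).
Proof.
(* [B] covers the linear bounds, where [d^t <= 6^(t - 1) d], and [B'] the cusp. *)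
move=> t1 M0 uv; pose B := 6 `^ (t - 1) * (480 + 24 / r).
pose B' := 180 `^ t * (M * 1000).
have t0 : 0 < t by lra.
have B0 : 0 < B.
  have gr : 0 < 24 / r by rewrite divr_gt0.
  by apply: mulr_gt0; [apply: powR_gt0|]; lra.
have B0' : 0 < B' by apply: mulr_gt0; [apply: powR_gt0|]; lra.
exists (B + B'); first by lra.
apply: (@curve_quasi_arc_pieces R 5 z (1 / 2) isT half01 _ f f_piece t _ isT t1).
- exact: vertex_ratio.
- exact: vertex_neq.
- by lra.
move=> i j s u p q ij j5 s01 u01 hp hq.
have [] := figure_diam ij j5 s01 u01 hp hq.
have e0 := dist_ge0 (S i (f s)) (S j (f u)); have d0 := dist_ge0 (f p) (f q).
move: (dist (S i _) _) (dist (f p) _) e0 d0 => e d e0 d0 d6.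
rewrite [(B + B') * e]mulrDl => -[h|[n [m [h gap]]]].
  apply: (@le_trans _ _ (B * e)); last first.
    by rewrite lerDl; exact: mulr_ge0 (ltW B0') e0.
  rewrite -(mulr_powRB1 d0 t0) mulrC -mulrA; apply: ler_pM; rewrite ?powR_ge0 //.
  by apply: ge0_ler_powR; rewrite ?nnegrE // ?subr_ge0 //; lra.
apply: (@le_trans _ _ (B' * e)); last first.
  by rewrite lerDr; exact: mulr_ge0 (ltW B0) e0.
set w := Num.max _ _ in h.
have w0 : 0 <= w by lra.
apply: (@le_trans _ _ ((180 * w) `^ t)).
  by apply: ge0_ler_powR h; rewrite ?nnegrE; [lra|exact: d0|lra].
have k0 : 0 <= 180 :> R by lra.
rewrite (powRM _ k0 w0).
rewrite -mulrA; apply: ler_wpM2l; first exact: powR_ge0.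
by rewrite -mulrA (le_trans (uv n m)) // ler_pM2l.
Qed.

(** The touching points: iterated images of the apex, which is the value of [f] at [3/5]. *)
Let left_point n : exists2 s, 0 <= s <= 1 & 1 - f s = (b ^+ n)%:C * (1 - apex R).
Proof.
elim: n => [|n [s s01 e]].
  exists ((3%:R + 0) / 5%:R); first by apply/andP; split; lra.
  rewrite f_piece //; last by apply/andP; split; lra.
  by rewrite f_0 piece_0 expr0 mul1r.
exists ((4%:R + s) / 5%:R); first by lra.
by rewrite f_piece // piece_last e mulrA -rmorphM -exprS.
Qed.

Let right_point m : exists2 s, 0 <= s <= 1 & f s = (a ^+ m)%:C * apex R.
Proof.
elim: m => [|m [s s01 e]].
  exists ((3%:R + 0) / 5%:R); first by apply/andP; split; lra.
  rewrite f_piece //; last by apply/andP; split; lra.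
  by rewrite f_0 piece_0 expr0 mul1r.
exists ((0%:R + s) / 5%:R); first by lra.
by rewrite f_piece // piece_first e mulrA -rmorphM -exprS.
Qed.

(** Test the touching points of the first two pieces, with [z 1] between them: they lie on the
    common ray, so their distance is a fixed multiple of the difference of the sizes. *)
Lemma figure_not_quasi_arc (t M : R) : 1 <= t -> 0 < M ->
  (forall x p y, 0 <= x -> y <= 1 -> x <= p <= y ->
    dist (f x) (f p) `^ t <= M * dist (f x) (f y)) ->
  forall n m, (left_size b n / 3) `^ t <= M * `|left_size b n - right_size r m|.
Proof.
move=> t1 M0 hM n m; have gr := r0; have gb := b0.
have [s s01 es] := left_point n; have [u u01 eu] := right_point m.
have := hM ((0%:R + s) / 5%:R) ((0%:R + 1) / 5%:R) ((1%:R + u) / 5%:R).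
have one01 : (0 <= (1 : R)) && ((1 : R) <= 1) by rewrite ler01 lexx.
rewrite !f_piece // f_1.
move=> /(_ ltac:(lra) ltac:(lra) ltac:(lra)) h.
have u0 : 0 < left_size b n by rewrite /left_size mulr_gt0 ?exprn_gt0 //; lra.
have lo : left_size b n / 3 <= dist (S 0 (f s)) (S 0 1).
  rewrite dist_piece.
  have -> : normc (z 1 - z 0) = a.
    by rewrite /= !subr0 expr0n addr0 sqrtr_sqr gtr0_norm // divr_gt0.
  rewrite dist_sym /dist es normcM normc_real gtr0_norm ?exprn_gt0 //.
  have : 1 / 2 <= normc (1 - apex R).
    by apply: le_trans (normc_geRe _); rewrite /= gtr0_norm; lra.
  move: u0; rewrite /left_size; move: (normc _) => N; nra.
have hi : dist (S 0 (f s)) (S 1 (f u)) <= `|left_size b n - right_size r m|.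
  rewrite /dist (le_trans (normc_leD _)) // !raddfB /= !Re_piece !Im_piece.
  have -> : f s = 1 - (b ^+ n)%:C * (1 - apex R) by rewrite -es opprB addrC subrK.
  rewrite eu /= /left_size /right_size.
  move: (b ^+ n) (a ^+ m) => B A.
  set v : R := a * B - r * A.
  rewrite [X in `|X| + _](_ : _ = - (1 / 2) * v); last by rewrite /v; field.
  rewrite [X in _ + `|X|](_ : _ = 1 / 6 * v); last by rewrite /v; field.
  have v0 := normr_ge0 v.
  have n2 : `|1 / 2 : R| = 1 / 2 by rewrite ger0_norm; lra.
  have n6 : `|1 / 6 : R| = 1 / 6 by rewrite ger0_norm; lra.
  by rewrite (normrM (- (1 / 2))) (normrM (1 / 6)) normrN n2 n6; lra.
apply: (@le_trans _ _ (dist (S 0 (f s)) (S 0 1) `^ t)).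
  by apply: ge0_ler_powR; rewrite ?nnegrE ?dist_ge0 //; lra.
by apply: le_trans h _; rewrite ler_pM2l.
Qed.

End FigureCurve.

(** * Rates of approximation and the quasi-arc condition *)

Section Sizes.
Variable R : realType.
Local Notation a := (4 / 9 : R).

Let a0 : 0 < a. Proof. by lra. Qed.
Let a01 : (0 < a) && (a <= 1). Proof. by apply/andP; split; lra. Qed.

Definition ratio_last : R := a `^ sqrt2 R.

Lemma ratio_last_bounds : 8 / 27 <= ratio_last <= 4 / 9.
Proof.
have /andP[s1 s2] := sqrt2_bounds R; rewrite /ratio_last; apply/andP; split.
  (* The lower bound is [(4/9)^(3/2)], and [sqrt 2 < 3/2]. *)
  have -> : 8 / 27 = a `^ (3%:R * 2^-1) :> R.
    rewrite powRrM powR_mulrn ?(ltW a0) // powR12_sqrt ?exprn_ge0 ?(ltW a0) //.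
    rewrite (_ : a ^+ 3 = (8 / 27) ^+ 2); last by field.
    by rewrite sqrtr_sqr gtr0_norm //; lra.
  by apply: ger_powR => //; lra.
by rewrite -[leRHS](powRr1 (ltW a0)); apply: ger_powR => //; lra.
Qed.

Definition decay : R := - ln a.

Lemma decay_gt0 : 0 < decay.
Proof. by rewrite oppr_gt0 ln_lt0 // a0 /=; lra. Qed.

Let powRE x : a `^ x = expR (- (decay * x)).
Proof. by rewrite /powR gt_eqF // /decay mulNr opprK mulrC. Qed.

Lemma decay_upper x : 1 - a `^ x <= decay * x.
Proof. by rewrite powRE; have := expR_ge1Dx (- (decay * x)); lra. Qed.

(** From [1 + y <= exp y] one gets [1 - exp (-y) >= y / (1 + y)], stated here without division. *)
Lemma decay_lower x : 0 <= x -> decay * x <= (1 + decay * x) * (1 - a `^ x).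
Proof.
move=> x0; rewrite powRE expRN; set y := decay * x.
have y0 : 0 <= y by rewrite mulr_ge0 // ltW // decay_gt0.
have := expR_ge1Dx y; have := expR_gt0 y; move: (expR y) => E E0 hE.
have : E^-1 * E = 1 by rewrite mulVf // gt_eqF.
have : 0 < E^-1 by rewrite invr_gt0.
nra.
Qed.

Variable kappa : R.
Hypothesis kappa_bounds : 0 <= kappa <= 1.

(** The 6 makes [r] at most [(4/9)^5 < 1/20]. The sizes have exponents [1 + n sqrt 2] and
    [6 - kappa + m], whence the shift [m + 5] in [gap]. *)
Definition ratio_second : R := a `^ (6 - kappa).

Lemma ratio_second_bounds : 0 < ratio_second <= 1 / 20.
Proof.
rewrite /ratio_second powR_gt0 //=; have /andP[k0 k1] := kappa_bounds.
apply: (@le_trans _ _ (a `^ 5%:R)).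
  by apply: ger_powR => //; lra.
by rewrite powR_mulrn ?(ltW a0) //; lra.
Qed.

Local Notation left n := (left_size ratio_last n).
Local Notation right m := (right_size ratio_second m).
Local Notation gap n m := (kappa + n%:R * sqrt2 R - (m + 5)%:R).

Lemma size_ratio n m : left n = right m * a `^ gap n m.
Proof.
rewrite /left_size /right_size /ratio_last /ratio_second.
rewrite -!powR_mulrn ?(ltW a0) ?powR_ge0 // -powRrM.
rewrite -{1}(powRr1 (ltW a0)) -!powRD ?(gt_eqF a0) ?implybT //.
by congr (_ `^ _); rewrite natrD; ring.
Qed.

Lemma left_gt0 n : 0 < left n.
Proof. by rewrite mulr_gt0 ?exprn_gt0 ?powR_gt0. Qed.

Lemma right_gt0 m : 0 < right m.
Proof. by rewrite mulr_gt0 ?exprn_gt0 ?powR_gt0. Qed.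

Lemma left_le1 n : left n <= ratio_last ^+ n.
Proof.
rewrite /left_size ger_pMl ?exprn_gt0 ?powR_gt0 //; lra.
Qed.

Lemma right_le1 m : right m <= 1.
Proof.
have /andP[r0 r1] := ratio_second_bounds.
have : a ^+ m <= 1 by apply: exprn_ile1; lra.
have : 0 < a ^+ m by rewrite exprn_gt0.
by rewrite /right_size; move: (a ^+ m) => A; nra.
Qed.

Lemma size_gap n m : `|left n - right m| =
  Num.max (left n) (right m) * (1 - a `^ `|gap n m|).
Proof.
have := size_ratio n m; have := right_gt0 m; have := left_gt0 n.
move: (left n) (right m) (gap n m) => u v D u0 v0 e.
have [D0|D0] := leP 0 D.
  have : a `^ D <= 1 by rewrite -[leRHS](powRr0 a); apply: ger_powR.
  rewrite (ger0_norm D0).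
  have := powR_gt0 D a0; move: e; move: (a `^ D) => A -> A0 A1.
  have h : v * A <= v by nra.
  by rewrite (max_idPr h) ler0_norm ?subr_le0 //; ring.
have e' : v = u * a `^ (- D) by rewrite e powRN mulfK // gt_eqF // powR_gt0.
have : a `^ (- D) <= 1 by rewrite -[leRHS](powRr0 a); apply: ger_powR => //; lra.
rewrite (ltr0_norm D0) {e}.
have := powR_gt0 (- D) a0; move: e'; move: (a `^ (- D)) => A -> A0 A1.
have h : u * A <= u by nra.
by rewrite (max_idPl h) ger0_norm ?subr_ge0 //; ring.
Qed.

Lemma size_max n m : `|gap n m| <= 1 ->
  Num.max (left n) (right m) <= 9 / 4 * left n.
Proof.
move=> D1; rewrite ge_max; have u0 := left_gt0 n; apply/andP; split; first by lra.
have v0 := right_gt0 m; rewrite (size_ratio n m).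
have : a <= a `^ gap n m.
  rewrite -[leLHS](powRr1 (ltW a0)); apply: ger_powR => //.
  by move: D1; rewrite ler_norml => /andP[].
by move: (a `^ _) (right m) v0 => A v v0; nra.
Qed.

End Sizes.

(** * From approximation rates to inequalities between sizes *)

Section Rates.
Variable R : realType.
Variables (kappa c : R) (psi : nat -> R).
Hypothesis kappa_bounds : 0 <= kappa <= 1.
Hypothesis c_bounds : 0 < c <= 1.
Hypothesis psi_gt0 : forall n, 0 < psi n.
Hypothesis psi_le : forall n, psi n * (n%:R + 1) <= 1.
Hypothesis far : forall n m,
  c * psi n <= `|kappa + n%:R * sqrt2 R - m%:R|.
Hypothesis near : forall N, exists n m, (N <= n)%N /\
  `|kappa + n%:R * sqrt2 R - m%:R| <= psi n.
Local Notation a := (4 / 9 : R).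
Local Notation left n := (left_size (ratio_last R) n).
Local Notation right m := (right_size (ratio_second kappa) m).
Local Notation gap n m := (kappa + n%:R * sqrt2 R - (m + 5)%:R).

Let a01 : (0 < a) && (a <= 1). Proof. by apply/andP; split; lra. Qed.
Let a0 : 0 < a. Proof. by lra. Qed.

Lemma psi_le1 n : psi n <= 1.
Proof.
have := psi_gt0 n; have := psi_le n; have : 0 <= n%:R :> R by [].
move: (psi n) => x; nra.
Qed.

Lemma size_neq n m : left n != right m.
Proof.
rewrite -subr_eq0 -normr_eq0 size_gap mulf_eq0 negb_or; apply/andP; split.
  by rewrite gt_eqF // lt_max left_gt0.
have g0 : 0 < `|gap n m|.
  by apply: lt_le_trans (far n (m + 5)); rewrite mulr_gt0 //; case/andP: c_bounds.
apply/eqP => e; have := @decay_lower R _ (ltW g0); rewrite e mulr0.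
by have := mulr_gt0 (@decay_gt0 R) g0; lra.
Qed.

(** This is [b^(n (t - 1))]: up to a constant, the [t]-th power of the left size divided by that
    size. *)
Definition rate (t : R) n : R := (ratio_last R `^ (t - 1)) ^+ n.

Let rateE t n : rate t n = (ratio_last R ^+ n) `^ (t - 1).
Proof.
by rewrite /rate -(powR_mulrn n (powR_ge0 _ _)) powRAC powR_mulrn // powR_ge0.
Qed.

(** Division by the larger size leaves its power [t - 1] against [1 - a^|gap|]. For a gap above 1
    the latter is at least 5/9; otherwise the larger size is comparable to [left n], and [far]
    bounds the latter below by a multiple of [psi n]. *)
Lemma max_size_le (t M : R) : 1 <= t -> 0 < M -> (forall n, rate t n <= M * psi n) ->
  exists2 M' : R, 0 < M' & forall n m,
    Num.max (left n) (right m) `^ t <= M' * `|left n - right m|.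
Proof.
move=> t1 M0 hM; have /andP[c0 c1] := c_bounds; have lam := @decay_gt0 R.
pose B := (9 / 4) `^ (t - 1) * M.
have B0 : 0 < B by rewrite mulr_gt0 // powR_gt0 //; lra.
have Bc : 0 < B * (1 + decay R) / (decay R * c).
  by rewrite divr_gt0 ?mulr_gt0 //; lra.
exists (B * (1 + decay R) / (decay R * c) + 9 / 5); first by lra.
move=> n m; rewrite size_gap; set q := Num.max _ _; set g := `|gap n m|.
have q0 : 0 < q by rewrite lt_max left_gt0.
have t0 : 0 < t by lra.
rewrite -(mulr_powRB1 (ltW q0) t0) mulrCA ler_pM2l //.
have g0 : 0 <= g by exact: normr_ge0.
have ag1 : a `^ g <= 1 by rewrite -[leRHS](powRr0 a); apply: ger_powR.
have [g1|g1] := leP g 1; last first.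
  have q1 : q `^ (t - 1) <= 1.
    have : q <= 1.
      rewrite ge_max right_le1 // andbT (le_trans (left_le1 R n)) //.
      have /andP[b0 b1] := ratio_last_bounds R.
      by apply: exprn_ile1; lra.
    move=> q1; apply: (@le_trans _ _ (1 `^ (t - 1))); last by rewrite powR1.
    by apply: ge0_ler_powR; rewrite ?nnegrE ?ler01 ?(ltW q0) // subr_ge0.
  have : a `^ g <= a.
    by rewrite -[leRHS](powRr1 (ltW a0)); apply: ger_powR => //; exact: ltW.
  move: (a `^ g) ag1 => A A1 hA; rewrite mulrDl.
  by have : 0 <= B * (1 + decay R) / (decay R * c) * (1 - A);
    [rewrite mulr_ge0 // ?(ltW Bc) // subr_ge0|lra].
have hq : q `^ (t - 1) <= B * psi n.
  apply: (@le_trans _ _ ((9 / 4 * left n) `^ (t - 1))).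
    apply: ge0_ler_powR; rewrite ?nnegrE ?(ltW q0) ?subr_ge0 //.
      by have := left_gt0 R n; lra.
    exact: size_max.
  have l0 := ltW (left_gt0 R n).
  rewrite powRM //.
  rewrite /B -mulrA ler_wpM2l ?powR_ge0 // (le_trans _ (hM n)) // rateE.
  apply: ge0_ler_powR; rewrite ?nnegrE ?l0 ?subr_ge0 //; last exact: left_le1.
  by rewrite exprn_ge0 // powR_ge0.
have lo : decay R * (c * psi n) <= (1 + decay R) * (1 - a `^ g).
  have cp0 : 0 <= c * psi n by rewrite mulr_ge0 // ltW.
  have cp1 : c * psi n <= 1.
    by have := psi_le1 n; have := psi_gt0 n; move: (psi n) => x; nra.
  apply: (le_trans (decay_lower cp0)).
  have h1 : a `^ g <= a `^ (c * psi n).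
    by apply: ger_powR => //; rewrite /g; exact: far.
  have h2 : a `^ (c * psi n) <= 1 by rewrite -[leRHS](powRr0 a); apply: ger_powR.
  by apply: ler_pM; [have := mulr_ge0 (ltW lam) cp0; lra|lra|rewrite lerD2l ger_pMr|lra].
apply: (le_trans hq); rewrite mulrDl.
apply: (@le_trans _ _ (B * (1 + decay R) / (decay R * c) * (1 - a `^ g))); last by lra.
rewrite [leRHS]mulrAC ler_pdivlMr ?mulr_gt0 //.
rewrite -[leRHS]mulrA; apply: le_trans (ler_wpM2l (ltW B0) lo).
by rewrite -[leLHS]mulrA [psi n * _]mulrCA [psi n * c]mulrC.
Qed.

Lemma rate_le (t M : R) : 1 <= t -> 0 < M ->
  (forall n m, (left n / 3) `^ t <= M * `|left n - right m|) ->
  exists2 M' : R, 0 < M' & forall N, exists2 n, (N <= n)%N & rate t n <= M' * psi n.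
Proof.
move=> t1 M0 hM; have lam := @decay_gt0 R.
pose A := a `^ (t - 1); have A0 : 0 < A by exact: powR_gt0.
pose B := 3^-1 `^ t; have B0 : 0 < B by apply: powR_gt0; lra.
exists (M * (9 / 4) * decay R / (B * A)); first by rewrite divr_gt0 ?mulr_gt0 //; lra.
(* For [n >= 10] an error of at most 1 forces [m >= 5], so that [m - 5] indexes a right size. *)
move=> N; have [n [m [Nn hnm]]] := near (maxn N 10).
move: Nn; rewrite geq_max => /andP[Nn n10]; exists n => //.
have m5 : (5 <= m)%N.
  rewrite leqNgt; apply/negP => m5.
  have m4 : m%:R <= 4 :> R by rewrite (ler_nat R m 4).
  have n10' : 10 <= n%:R :> R by rewrite (ler_nat R 10 n).
  have /andP[k0 k1] := kappa_bounds; have /andP[s1 s2] := sqrt2_bounds R.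
  have := psi_le1 n; move: hnm; rewrite ler_norml => /andP[_ h].
  nra.
have := hM n (m - 5)%N; rewrite size_gap subnK //.
set g := `|_| in hnm *; set l := left n.
have l0 : 0 < l := left_gt0 R n.
have g1 : g <= 1 by rewrite (le_trans hnm) // psi_le1.
have := @size_max R kappa n (m - 5)%N; rewrite subnK // => /(_ g1).
have := @decay_upper R g; set q := Num.max _ _ => hq1 hq2 h.
have q0 : 0 < q by rewrite lt_max l0.
have t0 : 0 < t by lra.
have e : (l / 3) `^ t = B * (l * (A * rate t n)).
  rewrite powRM ?(ltW l0) //.
  rewrite mulrC -(mulr_powRB1 (ltW l0) t0) /l /left_size rateE -powRM //.
  by rewrite exprn_ge0 // powR_ge0.
have h1 : q * (1 - a `^ g) <= 9 / 4 * l * (decay R * psi n).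
  apply: (@le_trans _ _ (q * (decay R * psi n))).
    by rewrite ler_wpM2l ?(ltW q0) // (le_trans hq1) // ler_wpM2l // ltW.
  by rewrite ler_wpM2r // mulr_ge0 // ltW.
rewrite mulrAC ler_pdivlMr ?mulr_gt0 // -(ler_pM2l l0).
have -> : l * (rate t n * (B * A)) = (l / 3) `^ t by rewrite e; ring.
apply: (le_trans h); apply: (@le_trans _ _ (M * (9 / 4 * l * (decay R * psi n)))).
  by rewrite ler_pM2l.
by rewrite le_eqVlt; apply/orP; left; apply/eqP; ring.
Qed.

End Rates.

(** * Arcs with a prescribed rate *)

Section Realization.
Variable R : realType.
Local Notation C := (plane R).

Lemma curve_self_similar (l : nat) (z : nat -> C) (f : R -> C) : (0 < l)%N ->
  z 0%N = 0 -> z l = 1 -> {within `[0, 1], continuous f} ->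
  (forall j s, (j < l)%N -> 0 <= s <= 1 -> f ((j%:R + s) / l%:R) = piece z j (f s)) ->
  self_similar_set l z (f @` `[0, 1]).
Proof.
move=> l0 z0 z1 cf fp; have L0 : 0 < l%:R :> R by rewrite ltr0n.
split.
- by exists (f 0), 0 => //; rewrite /= in_itv /= lexx ler01.
- by apply: continuous_compact => //; exact: segment_compact.
apply/seteqP; split=> p.
  move=> [t t01 <-].
  have t01' : 0 <= t <= 1 by [].
  have [dl s01] := digitP l0 t01'.
  exists (digit l t).+1 => //; exists (f (shift l t)); first by exists (shift l t).
  by rewrite simil_piece // -fp // -digit_shift.
move=> [[|j]// jl [_ [s s01 <-] <-]]; rewrite simil_piece //.
have [s0 s1] : 0 <= s /\ s <= 1 by apply/andP.
have jl' : (j < l)%N by case/andP: jl.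
rewrite -fp //; exists ((j%:R + s) / l%:R) => //=.
rewrite in_itv /= divr_ge0 ?(ltW L0) ?addr_ge0 //=.
rewrite ler_pdivrMr // mul1r (@le_trans _ _ (j.+1%:R)) ?ler_nat //.
by rewrite -natr1 lerD2l.
Qed.

(** The two implications are not exact converses: errors are bounded below for all pairs, but small
    ones are supplied only along an unbounded sequence of [n]. *)
Lemma arc_of_rate (psi : nat -> R) :
  (forall n, 0 < psi n) -> (forall n, psi n * (n%:R + 1) <= 1) ->
  exists (l : nat) (z : nat -> C) (q : nat) (L : set C),
  [/\ regular_self_similar_arc l z q L, theta_min l z q = 0,
      (forall t M, 1 <= t -> 0 < M -> (forall n, rate t n <= M * psi n) ->
        quasi_arc t L) &
      (forall t, 1 <= t -> quasi_arc t L -> exists2 M, 0 < M &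
        forall N, exists2 n, (N <= n)%N & rate t n <= M * psi n)].
Proof.
move=> psi0 psi1.
have [kappa [c [k01 c01 far near]]] := inhomogeneous_approximation psi0 psi1.
have bb := ratio_last_bounds R; have rb := ratio_second_bounds k01.
have half01 : (0 <= (1 / 2 : R)) && ((1 / 2 : R) < 1) by apply/andP; split; lra.
pose z := vertex (ratio_last R) (ratio_second kappa).
have z0 : z 0%N = 0 by [].
have z1 : z 5%N = 1 by [].
have ratio := vertex_ratio bb rb.
have [f [f0 f1 fp fK fA]] :=
  @self_similar_curve R 5 z (1 / 2) isT z0 z1 half01 ratio.
have fT : forall s, 0 <= s <= 1 -> model_triangle (f s).
  apply: fA; first by rewrite -closure_model_interior; exact: closed_closure.
    move=> s /andP[s0 s1]; apply/model_triangleE => /=.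
    by rewrite mulr0; split=> //; lra.
  by move=> j w; exact: piece_triangle.
have cf := @curve_continuous R 5 z (1 / 2) isT z0 z1 half01 ratio f fp fK.
have uv := size_neq c01 psi0 far.
have inj := figure_injective bb rb f0 f1 fp fT uv.
have [|g fg] := @injective_arc_param R f cf.
  by move=> s t; rewrite !inE => s01 t01; exact: inj.
exists 5%N, z, 3%N, (f @` `[0, 1]); split.
- split; first exact: figure_basic.
  + exact: figure_characteristic.
  + exact: curve_self_similar.
  + by exists f, g.
- exact: figure_theta_min.
- move=> t M t1 M0 /(max_size_le k01 c01 psi0 psi1 far t1 M0)[M' M'0 hM'].
  have [M'' M''0 h] := figure_curve_quasi_arc bb rb f0 f1 fp fT t1 M'0 hM'.
  by apply: (quasi_arc_curve fg _ M''0 h); lra.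
- move=> t t1 qa; have [K hK] := fK.
  have [|M M0 h] := curve_quasi_arc fg _ hK qa; first by lra.
  exact: (rate_le k01 psi0 psi1 near t1 M0
    (figure_not_quasi_arc bb rb f0 f1 fp t1 M0 h)).
Qed.

(** [1 - q^(n+1)] is [1 - q] times a sum of [n + 1] powers of [q], each at least [q^n]. *)
Lemma geometric_mul_le (q : R) n : 0 <= q <= 1 -> (n%:R + 1) * q ^+ n * (1 - q) <= 1.
Proof.
move=> /andP[q0 q1].
suff : (n%:R + 1) * q ^+ n * (1 - q) <= 1 - q ^+ n.+1.
  by have : 0 <= q ^+ n.+1 by [exact: exprn_ge0]; lra.
elim: n => [|n IH]; first by rewrite expr0 expr1 add0r mulr1 mul1r.
have : 0 <= q ^+ n by exact: exprn_ge0.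
have : q ^+ n <= 1 by exact: exprn_ile1.
move: IH; rewrite -natr1 !exprS; move: (n%:R) (q ^+ n) => N Q IH Q1 Q0.
have h1 : q * ((N + 1) * Q * (1 - q)) <= q * (1 - q * Q) by rewrite ler_wpM2l.
have h2 : 0 <= (1 - q) * (1 - q * Q) by apply: mulr_ge0; nra.
lra.
Qed.

Lemma rate_le1 (t : R) : 1 <= t -> 0 < ratio_last R `^ (t - 1) <= 1.
Proof.
move=> t1; have /andP[b0 b1] := ratio_last_bounds R.
rewrite powR_gt0 /=; last by lra.
rewrite -[leRHS](powRr0 (ratio_last R)); apply: ger_powR; last by lra.
by apply/andP; split; lra.
Qed.

Lemma rate_lt (s t : R) : s < t -> ratio_last R `^ (t - 1) < ratio_last R `^ (s - 1).
Proof.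
move=> st; have /andP[b0 b1] := ratio_last_bounds R.
have b : 0 < ratio_last R by lra.
have e : t - 1 = (s - 1) + (t - s) by ring.
rewrite e powRD; last by rewrite (gt_eqF b) implybT.
rewrite gtr_pMr ?powR_gt0 //.
apply: (@lt_le_trans _ _ (1 `^ (t - s))); last by rewrite powR1.
by apply: gt0_ltr_powR; rewrite ?nnegrE ?subr_gt0 ?ler01 //; lra.
Qed.

End Realization.

Theorem theorem7p7 (R : realType) :
  (exists (l : nat) (z : nat -> plane R) (q : nat) (L : set (plane R)),
     [/\ regular_self_similar_arc l z q L,
         theta_min l z q = 0 &
         forall t : R, 1 <= t -> ~ quasi_arc t L])
  /\
  (forall t0 : R, 1 < t0 ->
     exists (l : nat) (z : nat -> plane R) (q : nat) (L : set (plane R)),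
       [/\ regular_self_similar_arc l z q L,
           theta_min l z q = 0,
           quasi_arc t0 L &
           forall t : R, 1 <= t < t0 -> ~ quasi_arc t L])
  /\
  (forall t0 : R, 1 <= t0 ->
     exists (l : nat) (z : nat -> plane R) (q : nat) (L : set (plane R)),
       [/\ regular_self_similar_arc l z q L,
           theta_min l z q = 0,
           (forall t : R, t0 < t -> quasi_arc t L) &
           ~ quasi_arc t0 L]).
Proof.
have n1_gt0 n : 0 < n%:R + 1 :> R by have : 0 <= n%:R :> R by []; lra.
split; last split.
(* A superexponential [psi] falls below every geometric sequence [rate t]. *)
- have psi0 n : 0 < (n%:R + 1) ^- n.+1 :> R by rewrite invr_gt0 exprn_gt0.
  have psi1 n : (n%:R + 1) ^- n.+1 * (n%:R + 1) <= 1 :> R.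
    rewrite exprSr invfM -mulrA mulVf ?gt_eqF // mulr1.
    by rewrite invf_le1 ?exprn_gt0 // exprn_ege1 // lerDr.
  have [l [z [q [L [reg th _ notqa]]]]] := arc_of_rate psi0 psi1.
  exists l, z, q, L; split=> // t t1 /(notqa _ t1)[M M0 hM].
  have /andP[] := rate_le1 t1; set beta := _ `^ _ => b0 _.
  (* [n >= 1 / beta] makes [(beta (n + 1))^n] at least 1; then [n >= M] contradicts the estimate. *)
  have [n nN] := hM (maxn (Num.truncn (beta^-1)).+1 (Num.truncn M).+1).
  move: nN; rewrite geq_max => /andP[n1 n2].
  have h1 : beta^-1 <= n%:R.
    by rewrite (le_trans (ltW (truncnS_gt _))) // ler_nat.
  have h2 : M <= n%:R by rewrite (le_trans (ltW (truncnS_gt _))) // ler_nat.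
  rewrite /rate -/beta ler_pdivlMr ?exprn_gt0 // exprSr mulrA -exprMn.
  have : 1 <= (beta * (n%:R + 1)) ^+ n.
    apply: exprn_ege1; rewrite mulrC -ler_pdivrMr // div1r; lra.
  by have := n1_gt0 n; move: (_ ^+ n) => X; nra.
- move=> t0 t01; have t01' := ltW t01; have /andP[] := rate_le1 t01'.
  have := rate_lt t01; rewrite subrr powRr0; set beta := _ `^ _ => b1 b0 _.
  (* The rate of [t0] itself, scaled by [1 - beta] to stay below [1 / (n + 1)]; any [t < t0] has a
     larger base [gamma], and [(beta / gamma)^n] tends to 0. *)
  pose psi n := (1 - beta) * beta ^+ n.
  have psi0 n : 0 < psi n by rewrite mulr_gt0 ?exprn_gt0 ?subr_gt0.
  have psi1 n : psi n * (n%:R + 1) <= 1.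
    have := @geometric_mul_le R beta n; rewrite (ltW b0) (ltW b1) => /(_ isT).
    by apply: le_trans; rewrite /psi le_eqVlt; apply/orP; left; apply/eqP; ring.
  have [l [z [q [L [reg th qa notqa]]]]] := arc_of_rate psi0 psi1.
  exists l, z, q, L; split=> //.
    apply: (qa t0 (1 - beta)^-1) => //; first by rewrite invr_gt0 subr_gt0.
    by move=> n; rewrite /psi mulKf // subr_eq0 gt_eqF.
  move=> t /andP[t1 tt0] /(notqa _ t1)[M M0 hM].
  have /andP[] := rate_le1 t1; have := rate_lt tt0; rewrite -/beta.
  set gamma := _ `^ _ => bg g0 _.
  have q01 : 0 <= beta / gamma < 1.
    by rewrite divr_ge0 ?(ltW b0) ?(ltW g0) //= ltr_pdivrMr // mul1r.
  have x0 : 0 < (M * (1 - beta))^-1 by rewrite invr_gt0 mulr_gt0 // subr_gt0.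
  have [N hN] := exp_lt_exists q01 x0; have [n Nn] := hM N.
  rewrite /rate -/gamma /psi => hn.
  have : (beta / gamma) ^+ n < (M * (1 - beta))^-1.
    apply: le_lt_trans hN; have /andP[c0 c1] := q01.
    by apply: ler_wiXn2l => //; exact: ltW.
  rewrite expr_div_n ltr_pdivrMr ?exprn_gt0 // mulrC ltr_pdivlMr ?mulr_gt0 ?subr_gt0 //.
  by rewrite mulrC -mulrA ltNge hn.
- move=> t0 t01; have /andP[] := rate_le1 t01; set beta := _ `^ _ => b0 b1.
  (* The factor [1 / (n + 1)] spoils the exponent [t0], while for [t > t0] it is absorbed by the
     geometric gain [(gamma / beta)^n]. *)
  pose psi n := beta ^+ n / (n%:R + 1).
  have psi0 n : 0 < psi n by rewrite divr_gt0 ?exprn_gt0.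
  have psi1 n : psi n * (n%:R + 1) <= 1.
    by rewrite /psi divfK ?gt_eqF // exprn_ile1 // ltW.
  have [l [z [q [L [reg th qa notqa]]]]] := arc_of_rate psi0 psi1.
  exists l, z, q, L; split=> //.
    move=> t tt0; have := rate_lt tt0; rewrite -/beta.
    have t1 : 1 <= t by lra.
    have /andP[] := rate_le1 t1; set gamma := _ `^ _ => g0 _ gb.
    pose x := gamma / beta.
    have x0 : 0 <= x by rewrite divr_ge0 ?ltW.
    have x1 : x < 1 by rewrite ltr_pdivrMr // mul1r.
    apply: (qa t (1 - x)^-1) => //; first by rewrite invr_gt0 subr_gt0.
    move=> n; have := @geometric_mul_le R x n; rewrite x0 (ltW x1) => /(_ isT) h.
    rewrite /rate -/gamma /psi mulrC ler_pdivlMr ?subr_gt0 //.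
    have -> : gamma = x * beta by rewrite divfK // gt_eqF.
    rewrite ler_pdivlMr // exprMn.
    have := ler_wpM2r (ltW (exprn_gt0 n b0)) h; rewrite mul1r.
    by apply: le_trans; rewrite le_eqVlt; apply/orP; left; apply/eqP; ring.
  move=> /(notqa _ t01)[M M0 hM]; have [n nN] := hM (Num.truncn M).+1.
  have h2 : M <= n%:R by rewrite (le_trans (ltW (truncnS_gt _))) // ler_nat.
  rewrite /rate -/beta /psi mulrA ler_pdivlMr // mulrC ler_pM2r ?exprn_gt0 //.
  lra.
Qed.
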